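(* Let $G$ be a finitely generated torsion-free group, let $\delta\in\mathbb{Z}^n$ with $\delta\ge 0$, and let $l:G\to\mathbb{Z}^n$ be a proper, $\delta$-regular, $\delta$-hyperbolic length function such that (a) $ht(\delta)=1$, and (b) $G_1=\{g\in G\mid ht(l(g))\le 1\}$ is a finitely generated isolated subgroup of $G$. For $1\le k\le n$ put $G_k=\{g\in G\mid ht(l(g))\le k\}$. Then $G_1\le G_2\le\cdots\le G_n=G$, $G_1$ is a word hyperbolic group, and for every $k<n$ the group $G_{k+1}$ is isomorphic to an HNN extension of $G_k$ with a finite number of stable letters whose associated subgroups are virtually nilpotent of nilpotency class at most $3$.
   Context: $\mathbb{Z}^n$ (and $\mathbb{Q}^n$) carries the right lexicographic order: $(a_1,\dots,a_n)<(b_1,\dots,b_n)$ iff $a_j<b_j$ for the largest index $j$ with $a_j\ne b_j$. For nonzero $a\in\mathbb{Z}^n$, the height $ht(a)$ is the largest $k$ with $a_k\neq 0$; $ht(0)=0$. A length function on $G$ is a map $l:G\to\mathbb{Z}^n$ with $l(1)=0$, $l(g)\ge 0$, $l(g^{-1})=l(g)$ and $l(gh)\le l(g)+l(h)$ for all $g,h$. Put $c(g,h)=\tfrac12\big(l(g)+l(h)-l(g^{-1}h)\big)\in\mathbb{Q}^n$. $l$ is $\delta$-hyperbolic if $c(f,g)\ge\min\{c(f,h),c(g,h)\}-\delta$ for all $f,g,h\in G$. Write $g=a\circ b$ if $g=ab$ and $l(g)=l(a)+l(b)$. $l$ is $\delta$-regular if for all $g,h\in G$ there exist $g_c,h_c,g_d,h_d\in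 G$ with $l(g_c)=l(h_c)=c(g,h)$, $g=g_c\circ g_d$, $h=h_c\circ h_d$ and $l(g_c^{-1}h_c)\le 4\delta$. $l$ is proper if for every $k\in\mathbb{N}$ the set $\{g\in G\mid l(g)\le (k,0,\dots,0)\}$ is finite. A subgroup $H\le G$ is isolated if $g^m\in H$ for some nonzero integer $m$ implies $g\in H$. *)

(* Defs.v *)
From Stdlib Require Import ZArith List Arith.
Set Implicit Arguments.

Record Group : Type := MkGroup {
  gcar :> Type;
  gmul : gcar -> gcar -> gcar;
  ginv : gcar -> gcar;
  gone : gcar;
  gmulA : forall x y z, gmul x (gmul y z) = gmul (gmul x y) z;
  gmul1l : forall x, gmul gone x = x;
  gmul1r : forall x, gmul x gone = x;
  gmulVl : forall x, gmul (ginv x) x = gone;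
  gmulVr : forall x, gmul x (ginv x) = gone }.
Arguments gmul {g} _ _.
Arguments ginv {g} _.
Arguments gone {g}.

Fixpoint gpow {G : Group} (g : G) (k : nat) : G :=
  match k with O => gone | S k' => gmul g (gpow g k') end.

Definition gpowZ {G : Group} (g : G) (z : Z) : G :=
  match z with
  | Z0 => gone
  | Zpos p => gpow g (Pos.to_nat p)
  | Zneg p => ginv (gpow g (Pos.to_nat p))
  end.

Definition is_subgroup {G : Group} (P : G -> Prop) : Prop :=
  P gone /\ (forall x y, P x -> P y -> P (gmul x y)) /\ (forall x, P x -> P (ginv x)).

Definition word_eval {G : Group} (w : list G) : G := fold_right gmul gone w.
Definition word_over {G : Group} (S : list G) (w : list G) : Prop :=
  forall x, In x w -> In x S \/ In (ginv x) S.
Definition generates {G : Group} (S : list G) (P : G -> Prop) : Prop :=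
  (forall x, In x S -> P x) /\
  (forall g, P g -> exists w, word_over S w /\ word_eval w = g).
Definition fin_gen_sub {G : Group} (P : G -> Prop) : Prop := exists S, generates S P.
Definition fin_gen (G : Group) : Prop := fin_gen_sub (fun _ : G => True).

Definition torsion_free (G : Group) : Prop :=
  forall (g : G) (k : nat), (0 < k)%nat -> gpow g k = gone -> g = gone.

Definition isolated {G : Group} (P : G -> Prop) : Prop :=
  forall (g : G) (m : Z), m <> 0%Z -> P (gpowZ g m) -> P g.

Definition is_wlen {G : Group} (S : list G) (g : G) (m : nat) : Prop :=
  (exists w, word_over S w /\ word_eval w = g /\ length w = m) /\
  (forall w, word_over S w -> word_eval w = g -> (m <= length w)%nat).

(** Word hyperbolic (sub)group: for some finite generating set S, the word
    metric is Gromov delta-hyperbolic (Gromov-product definition, base point 1;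
    all quantities doubled to stay in Z). *)
Definition word_hyperbolic_sub {G : Group} (P : G -> Prop) : Prop :=
  exists S : list G, generates S P /\
  exists d : nat, forall x y z : G, P x -> P y -> P z ->
    forall lx ly lz lxy lxz lyz : nat,
      is_wlen S x lx -> is_wlen S y ly -> is_wlen S z lz ->
      is_wlen S (gmul (ginv x) y) lxy ->
      is_wlen S (gmul (ginv x) z) lxz ->
      is_wlen S (gmul (ginv y) z) lyz ->
      (Z.min (Z.of_nat lx + Z.of_nat lz - Z.of_nat lxz)
             (Z.of_nat ly + Z.of_nat lz - Z.of_nat lyz) - 2 * Z.of_nat d
       <= Z.of_nat lx + Z.of_nat ly - Z.of_nat lxy)%Z.

Definition comm {G : Group} (x y : G) : G :=
  gmul (gmul (ginv x) (ginv y)) (gmul x y).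
Definition nilpotent_class_le3 {G : Group} (N : G -> Prop) : Prop :=
  forall x1 x2 x3 x4, N x1 -> N x2 -> N x3 -> N x4 ->
    comm (comm (comm x1 x2) x3) x4 = gone.
Definition finite_index {G : Group} (N A : G -> Prop) : Prop :=
  exists reps : list G, (forall r, In r reps -> A r) /\
    forall a, A a -> exists r nn, In r reps /\ N nn /\ a = gmul r nn.
Definition virt_nilp3 {G : Group} (A : G -> Prop) : Prop :=
  exists N : G -> Prop, is_subgroup N /\ (forall x, N x -> A x) /\
    finite_index N A /\ nilpotent_class_le3 N.

(** HNN extensions, via their universal property.
    (PE, iota, t) is the HNN extension of the base PK with stable letters
    t 0 .. t (m-1) and associated isomorphisms phi i : A i -> B i. *)
Definition hom_on {G H : Group} (P : G -> Prop) (f : G -> H) : Prop :=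
  forall x y, P x -> P y -> f (gmul x y) = gmul (f x) (f y).

Definition is_HNN_extension {E K : Group} (PE : E -> Prop) (PK : K -> Prop)
    (m : nat) (A B : nat -> K -> Prop) (phi : nat -> K -> K)
    (iota : K -> E) (t : nat -> E) : Prop :=
  is_subgroup PE /\ is_subgroup PK /\
  (forall i, (i < m)%nat ->
     is_subgroup (A i) /\ is_subgroup (B i) /\
     (forall a, A i a -> PK a) /\ (forall b, B i b -> PK b) /\
     hom_on (A i) (phi i) /\ (forall a, A i a -> B i (phi i a)) /\
     (forall a a', A i a -> A i a' -> phi i a = phi i a' -> a = a') /\
     (forall b, B i b -> exists a, A i a /\ phi i a = b)) /\
  hom_on PK iota /\ (forall x, PK x -> PE (iota x)) /\
  (forall i, (i < m)%nat -> PE (t i)) /\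
  (forall i a, (i < m)%nat -> A i a ->
     gmul (gmul (t i) (iota a)) (ginv (t i)) = iota (phi i a)) /\
  (forall (H : Group) (f : K -> H) (s : nat -> H),
     hom_on PK f ->
     (forall i a, (i < m)%nat -> A i a ->
        gmul (gmul (s i) (f a)) (ginv (s i)) = f (phi i a)) ->
     (exists F : E -> H, hom_on PE F /\ (forall x, PK x -> F (iota x) = f x) /\
        (forall i, (i < m)%nat -> F (t i) = s i)) /\
     (forall F1 F2 : E -> H, hom_on PE F1 -> hom_on PE F2 ->
        (forall x, PK x -> F1 (iota x) = F2 (iota x)) ->
        (forall i, (i < m)%nat -> F1 (t i) = F2 (t i)) ->
        forall y, PE y -> F1 y = F2 y)).

(** * Z^n with the right lexicographic order.
    A vector of Z^n is a map nat -> Z of which only coordinates 1..n matter. *)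
Definition vec := nat -> Z.
Definition vzero : vec := fun _ => 0%Z.
Definition vadd (a b : vec) : vec := fun i => (a i + b i)%Z.
Definition vsub (a b : vec) : vec := fun i => (a i - b i)%Z.
Definition vscale (k : Z) (a : vec) : vec := fun i => (k * a i)%Z.

Fixpoint lexcmp (n : nat) (a b : vec) : comparison :=
  match n with
  | O => Eq
  | S m => match Z.compare (a (S m)) (b (S m)) with
           | Eq => lexcmp m a b
           | c => c
           end
  end.
Definition vle (n : nat) (a b : vec) : Prop := lexcmp n a b <> Gt.
Definition veq (n : nat) (a b : vec) : Prop := forall i, (1 <= i <= n)%nat -> a i = b i.
Definition vmin (n : nat) (a b : vec) : vec :=
  match lexcmp n a b with Gt => b | _ => a end.

Fixpoint ht (n : nat) (a : vec) : nat :=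
  match n with
  | O => O
  | S m => if Z.eqb (a (S m)) 0 then ht m a else S m
  end.

Definition kvec (k : nat) : vec := fun i => if Nat.eqb i 1 then Z.of_nat k else 0%Z.

Definition length_function {G : Group} (n : nat) (l : G -> vec) : Prop :=
  veq n (l gone) vzero /\
  (forall g, vle n vzero (l g)) /\
  (forall g, veq n (l (ginv g)) (l g)) /\
  (forall g h, vle n (l (gmul g h)) (vadd (l g) (l h))).

(** c2 l g h = 2 c(g,h) = l(g) + l(h) - l(g^-1 h) *)
Definition c2 {G : Group} (l : G -> vec) (g h : G) : vec :=
  vsub (vadd (l g) (l h)) (l (gmul (ginv g) h)).

(** c(f,g) >= min{c(f,h), c(g,h)} - delta, multiplied by 2 *)
Definition hyperbolic_lf {G : Group} (n : nat) (l : G -> vec) (delta : vec) : Prop :=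
  forall f g h : G,
    vle n (vsub (vmin n (c2 l f h) (c2 l g h)) (vscale 2 delta)) (c2 l f g).

Definition decomp {G : Group} (n : nat) (l : G -> vec) (g a b : G) : Prop :=
  g = gmul a b /\ veq n (l g) (vadd (l a) (l b)).

Definition regular_lf {G : Group} (n : nat) (l : G -> vec) (delta : vec) : Prop :=
  forall g h : G, exists gc hc gd hd : G,
    veq n (vscale 2 (l gc)) (c2 l g h) /\
    veq n (vscale 2 (l hc)) (c2 l g h) /\
    decomp n l g gc gd /\ decomp n l h hc hd /\
    vle n (l (gmul (ginv gc) hc)) (vscale 4 delta).

Definition proper_lf {G : Group} (n : nat) (l : G -> vec) : Prop :=
  forall k : nat, exists L : list G, forall g, vle n (l g) (kvec k) -> In g L.

Definition Gk {G : Group} (n : nat) (l : G -> vec) (k : nat) : G -> Prop :=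
  fun g => (ht n (l g) <= k)%nat.

(* Main.v *)
(* Write [d(x,y) = l(x^-1 y)].  Since [delta] has height 1, the top coordinate of
   [l] on [G_(k+1)] is an integer-valued 0-hyperbolic length function with kernel
   [G_k], and by regularity its branch points are orbit points.  So [G_(k+1)] acts
   on a tree, transitively on vertices, with vertex stabilizer [G_k], and reduced
   words in [G_k] and edge representatives do not collapse: this gives the HNN
   presentation, provided no edge is flipped.

   Let [t] move the base vertex along an edge, with edge stabilizer [A].  On [A]
   the shift [tau a = d(a,t) - d(1,t)] is a quasimorphism with defect [2 delta].
   Far along the geodesic from [1] to [t], elements of [A] with [|tau| <= M] move
   points by a bounded amount, so by properness there are finitely many of them.
   Commutators have bounded [tau], hence are finitely many, which makes [A]
   virtually nilpotent of class 2; the coordinates of [tau] show that [A] is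
   finitely generated; and if [t] flips its edge, the powers of [t^2] have bounded
   [tau], so [t] is torsion.  Finite generation of the edge groups passes finite
   generation from [G_(k+1)] down to [G_k], whence finitely many stable letters.

   On [G_1] regularity and finite generation make [l] coarsely geodesic, so [l] is
   comparable with a word metric, and a Morse lemma transfers hyperbolicity. *)

Require Import Defs.
From Stdlib Require Import ZArith List Arith Lia Classical ClassicalEpsilon FinFun.
From Stdlib Require Import FunctionalExtensionality PropExtensionality.
Import ListNotations.

(** * Groups and generated subgroups *)

(** Only [G] and [G_1] are given as finitely generated, while finitely many stable letters for
    [G_(k+1)] require finite generation of [G_(k+1)], so finiteness has to descend from [G_n = G]
    one level at a time. The normal-form argument therefore has two parameters, a base [K0] inside
    the vertex stabilizer and a target group [H]. With [K0] the whole stabilizer and [H] arbitrary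
    it constructs the homomorphism of the universal property; with [K0] finitely generated and
    containing the edge groups, and [H] trivial, it shows that [K0] is already the whole stabilizer.

    Finiteness of a set of bounded shift meets the obstacle that the point which its elements move
    little depends on their lengths, and a priori no point serves infinitely many elements. So the
    sizes of finite subsets are bounded instead: the longest member of a subset dictates a point,
    and conjugation by it puts the subset into a ball whose cardinality is the same for all
    subsets. *)

Lemma gmulVK (G : Group) (x y : G) : gmul x (gmul (ginv x) y) = y.
Proof. now rewrite gmulA, gmulVr, gmul1l. Qed.

Lemma gmulKV (G : Group) (x y : G) : gmul (ginv x) (gmul x y) = y.
Proof. now rewrite gmulA, gmulVl, gmul1l. Qed.

Lemma gmul_cancel_l (G : Group) (x y z : G) : gmul x y = gmul x z -> y = z.
Proof. intros E. now rewrite <- (gmulKV G x y), E, gmulKV. Qed.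

Lemma ginv_unique (G : Group) (x y : G) : gmul x y = gone -> y = ginv x.
Proof. intros E. apply (gmul_cancel_l G x). now rewrite E, gmulVr. Qed.

Lemma ginv_mul (G : Group) (x y : G) : ginv (gmul x y) = gmul (ginv y) (ginv x).
Proof.
  symmetry. apply ginv_unique.
  now rewrite <- gmulA, (gmulA G y), gmulVr, gmul1l, gmulVr.
Qed.

Lemma ginv_inv (G : Group) (x : G) : ginv (ginv x) = x.
Proof. symmetry. apply ginv_unique, gmulVl. Qed.

Lemma ginv_one (G : Group) : ginv (@gone G) = gone.
Proof. symmetry. apply ginv_unique, gmul1l. Qed.

Lemma gmulA_r (G : Group) (x y z : G) : gmul (gmul x y) z = gmul x (gmul y z).
Proof. symmetry. apply gmulA. Qed.

Hint Rewrite gmulA_r gmul1l gmul1r gmulVl gmulVr gmulVK gmulKV ginv_mul ginv_inv ginv_one : grp.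
Ltac grp := autorewrite with grp; reflexivity.

Section Subgroups.
Variables (G : Group) (P : G -> Prop).
Hypothesis HP : is_subgroup P.

Lemma sub_one : P gone.
Proof. exact (proj1 HP). Qed.

Lemma sub_mul x y : P x -> P y -> P (gmul x y).
Proof. exact (proj1 (proj2 HP) x y). Qed.

Lemma sub_inv x : P x -> P (ginv x).
Proof. exact (proj2 (proj2 HP) x). Qed.

Lemma sub_word_eval S w : (forall x, In x S -> P x) -> word_over S w -> P (word_eval w).
Proof.
  intros HS. induction w as [|x w IH]; intros Hw; simpl.
  - apply sub_one.
  - apply sub_mul.
    + destruct (Hw x (or_introl eq_refl)) as [Hx|Hx]; auto.
      rewrite <- (ginv_inv G x). now apply sub_inv, HS.
    + apply IH. intros y Hy. apply Hw. now right.
Qed.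
End Subgroups.

Definition gen {G : Group} (S : list G) (g : G) : Prop :=
  exists w, word_over S w /\ word_eval w = g.

Lemma word_eval_app (G : Group) (v w : list G) :
  word_eval (v ++ w) = gmul (word_eval v) (word_eval w).
Proof. induction v as [|x v IH]; simpl; [|rewrite IH]; grp. Qed.

Lemma word_over_app (G : Group) (S v w : list G) :
  word_over S v -> word_over S w -> word_over S (v ++ w).
Proof. intros Hv Hw x Hx. apply in_app_or in Hx. destruct Hx; auto. Qed.

Lemma word_over_inv (G : Group) (S w : list G) :
  word_over S w -> word_over S (rev (map ginv w)).
Proof.
  intros Hw x Hx. apply in_rev, in_map_iff in Hx. destruct Hx as [y [<- Hy]].
  destruct (Hw y Hy); [right; now rewrite ginv_inv | now left].
Qed.

Lemma word_eval_inv (G : Group) (w : list G) :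
  word_eval (rev (map ginv w)) = ginv (word_eval w).
Proof.
  induction w as [|x w IH]; simpl; [grp|].
  rewrite word_eval_app, IH. simpl. grp.
Qed.

Lemma gen_subgroup (G : Group) (S : list G) : is_subgroup (gen S).
Proof.
  split; [|split].
  - exists []. split; [intros x []|reflexivity].
  - intros x y [v [Hv <-]] [w [Hw <-]]. exists (v ++ w).
    split; [now apply word_over_app|apply word_eval_app].
  - intros x [w [Hw <-]]. exists (rev (map ginv w)).
    split; [now apply word_over_inv|apply word_eval_inv].
Qed.

Lemma gen_in (G : Group) (S : list G) x : In x S -> gen S x.
Proof.
  intros Hx. exists [x]. split; [|simpl; grp].
  intros y [<-|[]]. now left.
Qed.

Lemma gen_least (G : Group) (S : list G) (P : G -> Prop) :
  is_subgroup P -> (forall x, In x S -> P x) -> forall g, gen S g -> P g.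
Proof. intros HP HS g [w [Hw <-]]. now apply (sub_word_eval G P HP S). Qed.

Lemma gen_incl (G : Group) (S T : list G) : incl S T -> forall g, gen S g -> gen T g.
Proof. intros H. apply gen_least; [apply gen_subgroup|]. intros x Hx. now apply gen_in, H. Qed.

Lemma fin_gen_sub_intro (G : Group) (S : list G) (P : G -> Prop) :
  (forall x, In x S -> P x) -> (forall g, P g -> gen S g) -> fin_gen_sub P.
Proof. intros H1 H2. exists S. now split. Qed.

Lemma gpow_add (G : Group) (g : G) a b : gpow g (a + b) = gmul (gpow g a) (gpow g b).
Proof. induction a as [|a IH]; simpl; [|rewrite IH]; grp. Qed.

Lemma sub_gpow (G : Group) (P : G -> Prop) (g : G) m : is_subgroup P -> P g -> P (gpow g m).
Proof.
  intros HP Hg. induction m as [|m IH]; simpl; [now apply sub_one|now apply sub_mul].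
Qed.

(** * Finiteness *)

(** Yields finiteness when each finite subset is bounded by an argument that depends on the subset:
    otherwise duplicate-free lists could be grown to any length. *)
Lemma finite_of_bounded (X : Type) (Q : X -> Prop) (N : nat) :
  (forall F, NoDup F -> (forall c, In c F -> Q c) -> length F <= N) ->
  exists F, forall c, Q c -> In c F.
Proof.
  intros HN. apply NNPP. intros Hno.
  assert (HF : forall m, exists F, NoDup F /\ (forall c, In c F -> Q c) /\ length F = m).
  { induction m as [|m [F [HF1 [HF2 HF3]]]].
    - exists []. repeat split; [constructor|intros c []].
    - apply NNPP. intros Hm. apply Hno. exists F. intros c Hc. apply NNPP. intros Hin.
      apply Hm. exists (c :: F). split; [now constructor|]. split; [|simpl; lia].
      intros x [<-|Hx]; auto. }
  destruct (HF (S N)) as [F [HF1 [HF2 HF3]]]. specialize (HN F HF1 HF2). lia.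
Qed.

Lemma list_restrict (X : Type) (Q : X -> Prop) (F : list X) :
  exists F', forall c, In c F' <-> In c F /\ Q c.
Proof.
  induction F as [|x F [F' HF']].
  - exists []. simpl. tauto.
  - destruct (classic (Q x)) as [Hx|Hx].
    + exists (x :: F'). intros c. simpl. rewrite HF'. split; [|tauto].
      intros [<-|[? ?]]; tauto.
    + exists F'. intros c. rewrite HF'. simpl. split; [tauto|].
      intros [[<-|?] ?]; tauto.
Qed.

Lemma finite_representatives (X Y : Type) (Q : X -> Prop) (f : X -> Y) (ys : list Y) :
  (forall x, Q x -> In (f x) ys) ->
  exists rs, (forall r, In r rs -> Q r) /\ forall x, Q x -> exists r, In r rs /\ f r = f x.
Proof.
  revert Q. induction ys as [|y ys IH]; intros Q H.
  - exists []. split; [intros r []|]. intros x Hx. destruct (H x Hx).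
  - destruct (IH (fun x => Q x /\ f x <> y)) as [rs [H1 H2]].
    { intros x [Hx Hy]. destruct (H x Hx) as [E|E]; [exfalso; auto|exact E]. }
    assert (H2' : forall x, Q x -> f x <> y -> exists r, In r rs /\ f r = f x)
      by (intros x Hx Hy; apply H2; auto).
    destruct (classic (exists x, Q x /\ f x = y)) as [[x0 [Hx0 Hy0]]|Hno].
    + exists (x0 :: rs). split.
      { intros r [<-|Hr]; [assumption|now apply H1]. }
      intros x Hx. destruct (classic (f x = y)) as [E|E].
      * exists x0. split; [now left|congruence].
      * destruct (H2' x Hx E) as [r [Hr Er]]. exists r. split; [now right|exact Er].
    + exists rs. split; [intros r Hr; now apply H1|].
      intros x Hx. apply H2'; [assumption|]. intros E. apply Hno. now exists x.
Qed.

Lemma lists_over_finite (X : Type) (F : list X) (m : nat) :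
  exists Fs, forall xs, length xs = m -> (forall x, In x xs -> In x F) -> In xs Fs.
Proof.
  induction m as [|m [Fs HFs]].
  - exists [[]]. intros [|x xs] H; [now left|discriminate].
  - exists (map (fun p => fst p :: snd p) (list_prod F Fs)).
    intros [|x xs] H1 H2; [discriminate|].
    apply in_map_iff. exists (x, xs). split; [reflexivity|].
    apply in_prod; [apply H2; now left|]. apply HFs; [simpl in H1; lia|].
    intros y Hy. apply H2. now right.
Qed.

(** * The lexicographic order *)

Definition additive (n : nat) (phi : vec -> Z) : Prop :=
  (forall a b, phi (vadd a b) = (phi a + phi b)%Z) /\
  (forall a b, phi (vsub a b) = (phi a - phi b)%Z) /\
  (forall z a, phi (vscale z a) = (z * phi a)%Z) /\
  (phi vzero = 0%Z) /\
  (forall a b, veq n a b -> phi a = phi b).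

Lemma vle_S n a b :
  vle (S n) a b <-> (a (S n) < b (S n))%Z \/ (a (S n) = b (S n) /\ vle n a b).
Proof.
  unfold vle. simpl. destruct (Z.compare_spec (a (S n)) (b (S n))); split; intros; try lia.
  - now right.
  - destruct H0 as [?|[_ ?]]; [lia|assumption].
  - discriminate.
  - congruence.
Qed.

(* A sufficiently steep weighting of the coordinates realises any finite amount
   of lexicographic information in [Z], where [lia] applies. *)
Lemma weights_exist (n : nat) (ps : list (vec * vec)) :
  exists phi, additive n phi /\
    forall p, In p ps -> (vle n (fst p) (snd p) <-> (phi (fst p) <= phi (snd p))%Z).
Proof.
  induction n as [|n [phi [[H1 [H2 [H3 [H4 H5]]]] H6]]].
  - exists (fun _ => 0%Z). split; [repeat split; intros; lia|].
    intros p _. split; [lia|]. intros _. unfold vle. simpl. discriminate.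
  - assert (HB : exists B, (0 < B)%Z /\ forall p, In p ps ->
        (Z.abs (phi (fst p) - phi (snd p)) < B)%Z).
    { clear. induction ps as [|p ps [B [HB1 HB2]]].
      - exists 1%Z. split; [lia|intros p []].
      - exists (B + Z.abs (phi (fst p) - phi (snd p)))%Z. split; [lia|].
        intros q [<-|Hq]; [lia|]. specialize (HB2 q Hq). lia. }
    destruct HB as [B [HB1 HB2]].
    (* [B] exceeds every difference of lower-order weights, so the new top coordinate decides unless
       it agrees on both sides. *)
    exists (fun a => phi a + B * a (S n))%Z. split.
    + repeat split; intros.
      * rewrite H1. unfold vadd. lia.
      * rewrite H2. unfold vsub. lia.
      * rewrite H3. unfold vscale. lia.
      * rewrite H4. unfold vzero. lia.
      * rewrite (H5 a b), (H (S n)); [lia|lia|]. intros i Hi. apply H. lia.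
    + intros p Hp. rewrite vle_S, (H6 p Hp). specialize (HB2 p Hp).
      set (u := fst p (S n)) in *. set (v := snd p (S n)) in *.
      split; [nia|]. intros Hle.
      destruct (Z.lt_trichotomy u v) as [?|[?|?]]; [now left|right; subst u v; nia|nia].
Qed.

Ltac vcollect n acc k :=
  match goal with
  | H : vle n ?x ?y |- _ =>
      lazymatch acc with
      | context [ (x, y) ] => fail
      | _ => vcollect n (cons (x, y) acc) k
      end
  | _ => k acc
  end.

Ltac vphi_rewrite phi H1 H2 H3 H4 :=
  repeat first [ rewrite H1 in * | rewrite H2 in * | rewrite H3 in * | rewrite H4 in * ].

(** One weighting serves the goal and all [vle] hypotheses. Hypotheses are carried to [Z] by one
    direction of its equivalence and the goal by the other. *)
Ltac vlia :=
  unfold c2 in *;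
  lazymatch goal with
  | |- vle ?n ?x ?y =>
    vcollect n (cons (x, y) nil) ltac:(fun ps =>
      let phi := fresh "phi" in
      let A1 := fresh in let A2 := fresh in let A3 := fresh in
      let A4 := fresh in let A5 := fresh in let A6 := fresh in
      destruct (weights_exist n ps) as [phi [[A1 [A2 [A3 [A4 A5]]]] A6]];
      apply (A6 (x, y)); [simpl; tauto|];
      repeat match goal with
      | H : vle n ?u ?v |- _ =>
          apply (A6 (u, v)) in H; [|simpl; tauto]
      | H : veq n ?u ?v |- _ => apply A5 in H
      end;
      clear A5 A6; cbn [fst snd] in *;
      vphi_rewrite phi A1 A2 A3 A4; lia)
  end.

Lemma vle_refl n a : vle n a a.
Proof. vlia. Qed.

Lemma vle_total n a b : vle n a b \/ vle n b a.
Proof.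
  induction n as [|n IH].
  - left. unfold vle. simpl. discriminate.
  - rewrite !vle_S. destruct (Z.lt_trichotomy (a (S n)) (b (S n))) as [?|[?|?]]; tauto || auto.
    destruct IH; [left|right]; right; split; auto.
Qed.

Lemma vmin_cases n a b c : vle n (vmin n a b) c -> vle n a c \/ vle n b c.
Proof. unfold vmin. destruct (lexcmp n a b); auto. Qed.

Lemma vle_coord n a b j :
  vle n a b -> 1 <= j <= n -> (forall i, j < i <= n -> a i = b i) -> (a j <= b j)%Z.
Proof.
  induction n as [|n IH]; intros H Hj He; [lia|].
  apply vle_S in H. destruct (Nat.eq_dec j (S n)) as [->|Hne]; [destruct H; lia|].
  destruct H as [H|[_ H]].
  - rewrite (He (S n)) in H; lia.
  - apply IH; [assumption|lia|]. intros i Hi. apply He. lia.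
Qed.

Lemma vle_of_coord n (a b : vec) :
  (a 1%nat <= b 1%nat)%Z -> (forall i, 1 < i <= n -> a i = b i) -> vle n a b.
Proof.
  intros H1. induction n as [|n IH]; intros He.
  - unfold vle. simpl. discriminate.
  - apply vle_S. destruct n as [|n].
    + destruct (Z.lt_trichotomy (a 1%nat) (b 1%nat)) as [?|[?|?]]; [now left|right|lia].
      split; [assumption|]. unfold vle. simpl. discriminate.
    + right. split; [apply He; lia|]. apply IH. intros i Hi. apply He. lia.
Qed.

Lemma ht_le_iff n (a : vec) k : ht n a <= k <-> forall i, k < i <= n -> a i = 0%Z.
Proof.
  induction n as [|n IH]; simpl.
  - split; intros; lia.
  - destruct (Z.eqb_spec (a (S n)) 0) as [E|E].
    + rewrite IH. split; intros H i Hi.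
      * destruct (Nat.eq_dec i (S n)) as [->|]; [assumption|]. apply H. lia.
      * apply H. lia.
    + split; intros H.
      * intros i Hi. lia.
      * apply Nat.le_ngt. intros Hk. apply E, H. lia.
Qed.

(** Going down from coordinate [n], equality of all higher coordinates lets the order squeeze [a i]
    between [0] and [b i = 0]. *)
Lemma nonneg_le_coord0 n a b k :
  vle n vzero a -> vle n a b ->
  (forall i, k < i <= n -> b i = 0%Z) -> forall i, k < i <= n -> a i = 0%Z.
Proof.
  intros H0 Hab Hb.
  assert (H : forall m i, n - m < i <= n -> k < i -> a i = 0%Z).
  { induction m as [|m IH]; intros i Hi Hk; [lia|].
    destruct (Nat.le_gt_cases i (n - m)); [|apply IH; lia].
    assert (a i <= b i)%Z.
    { apply (vle_coord n); [assumption|lia|]. intros j Hj.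
      rewrite (Hb j) by lia. apply IH; lia. }
    assert (vzero i <= a i)%Z.
    { apply (vle_coord n); [assumption|lia|]. intros j Hj. symmetry. apply IH; lia. }
    rewrite Hb in * by lia. unfold vzero in *. lia. }
  intros i Hi. apply (H n); lia.
Qed.

(** Integer version of [kvec], so that lower bounds [kv (- M)] can be written; [kv (Z.of_nat m)] and
    [kvec m] are convertible. *)
Definition kv (z : Z) : vec := fun i => if Nat.eqb i 1 then z else 0%Z.

Lemma kv_coord z i : 1 < i -> kv z i = 0%Z.
Proof. intros Hi. unfold kv. destruct (Nat.eqb_spec i 1); [lia|reflexivity]. Qed.

Lemma kv_bounded n (v : vec) (M : Z) :
  1 <= n -> vle n v (kv M) -> vle n (kv (- M)) v ->
  (Z.abs (v 1%nat) <= M)%Z /\ forall i, 1 < i <= n -> v i = 0%Z.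
Proof.
  intros Hn Hu Hl.
  assert (H : forall m i, n - m < i <= n -> 1 < i -> v i = 0%Z).
  { induction m as [|m IH]; intros i Hi Hk; [lia|].
    destruct (Nat.le_gt_cases i (n - m)); [|apply IH; lia].
    assert (v i <= kv M i)%Z.
    { apply (vle_coord n); [assumption|lia|]. intros j Hj. rewrite kv_coord by lia. apply IH; lia. }
    assert (kv (- M) i <= v i)%Z.
    { apply (vle_coord n); [assumption|lia|]. intros j Hj. rewrite kv_coord by lia. symmetry. apply IH; lia. }
    rewrite kv_coord in * by lia. lia. }
  assert (H' : forall i, 1 < i <= n -> v i = 0%Z) by (intros i Hi; apply (H n); lia).
  split; [|exact H'].
  assert (v 1%nat <= kv M 1%nat)%Z.
  { apply (vle_coord n); [assumption|lia|]. intros j Hj. rewrite H' by lia.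
    unfold kv. destruct (Nat.eqb_spec j 1); [lia|reflexivity]. }
  assert (kv (- M) 1%nat <= v 1%nat)%Z.
  { apply (vle_coord n); [assumption|lia|]. intros j Hj. rewrite H' by lia.
    unfold kv. destruct (Nat.eqb_spec j 1); [lia|reflexivity]. }
  unfold kv in *. simpl in *. lia.
Qed.

Lemma kv_add n a b : veq n (kv (a + b)) (vadd (kv a) (kv b)).
Proof. intros i _. unfold kv, vadd. destruct (Nat.eqb i 1); lia. Qed.

Lemma kv_scale n z a : veq n (kv (z * a)) (vscale z (kv a)).
Proof. intros i _. unfold kv, vscale. destruct (Nat.eqb i 1); lia. Qed.

Lemma kv_opp n a : veq n (kv (- a)) (vsub vzero (kv a)).
Proof. intros i _. unfold kv, vsub, vzero. destruct (Nat.eqb i 1); lia. Qed.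

(** * Integer-valued free length functions *)

(** [tl_hyp] is 0-hyperbolicity with doubled products and common terms cancelled. In [tl_reg] a
    single [u] serves both elements: it is the branch point of the segments from the base vertex to
    its images under [g] and [h]. *)
Record tree_length {G : Group} (P : G -> Prop) (L : G -> Z) : Prop := {
  tl_sub : is_subgroup P;
  tl_one : L gone = 0%Z;
  tl_nonneg : forall g, P g -> (0 <= L g)%Z;
  tl_inv : forall g, P g -> L (ginv g) = L g;
  tl_tri : forall g h, P g -> P h -> (L (gmul g h) <= L g + L h)%Z;
  tl_hyp : forall f g h, P f -> P g -> P h ->
    (L (gmul (ginv f) g) + L h <= L (gmul (ginv f) h) + L g)%Z \/
    (L (gmul (ginv f) g) + L h <= L (gmul (ginv g) h) + L f)%Z;
  tl_reg : forall g h, P g -> P h -> exists u, P u /\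
    (2 * L u = L g + L h - L (gmul (ginv g) h))%Z /\
    (L u + L (gmul (ginv u) g) = L g)%Z /\
    (L u + L (gmul (ginv u) h) = L h)%Z }.

(** Target for normal forms when only membership in the base matters. *)
Definition trivial_group : Group :=
  @MkGroup unit (fun _ _ => tt) (fun _ => tt) tt (fun _ _ _ => eq_refl)
    (fun x => match x with tt => eq_refl end) (fun x => match x with tt => eq_refl end)
    (fun _ => eq_refl) (fun _ => eq_refl).

Definition length_kernel {G : Group} (P : G -> Prop) (L : G -> Z) (g : G) : Prop :=
  P g /\ L g = 0%Z.

Section Tree.
Variables (G : Group) (P : G -> Prop) (L : G -> Z).
Hypothesis TL : tree_length P L.

Let K := length_kernel P L.

Let SP := tl_sub P L TL.

Lemma tree_kernel_subgroup : is_subgroup K.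
Proof.
  split; [|split].
  - split; [now apply sub_one|apply (tl_one P L TL)].
  - intros x y [Hx Ex] [Hy Ey]. assert (Hxy : P (gmul x y)) by (apply sub_mul; auto).
    split; [assumption|].
    pose proof (tl_tri P L TL x y Hx Hy). pose proof (tl_nonneg P L TL _ Hxy). lia.
  - intros x [Hx Ex]. split; [now apply sub_inv|]. now rewrite (tl_inv P L TL).
Qed.

Let SK := tree_kernel_subgroup.

Lemma tree_length_mul_kernel_l k g : K k -> P g -> L (gmul k g) = L g.
Proof.
  intros [Hk Ek] Hg.
  pose proof (tl_tri P L TL k g Hk Hg).
  pose proof (tl_tri P L TL (ginv k) (gmul k g) (sub_inv G P SP k Hk) (sub_mul G P SP _ _ Hk Hg)) as H0.
  rewrite gmulKV, (tl_inv P L TL) in H0 by assumption. lia.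
Qed.

Lemma tree_length_mul_kernel_r k g : K k -> P g -> L (gmul g k) = L g.
Proof.
  intros Hk Hg. pose proof (proj1 Hk).
  assert (P (gmul g k)) by (apply sub_mul; auto).
  rewrite <- (tl_inv P L TL), ginv_mul by assumption.
  rewrite tree_length_mul_kernel_l; [now apply (tl_inv P L TL)| |now apply sub_inv].
  now apply sub_inv.
Qed.

(** No orbit point lies strictly inside the segment from the base vertex to its image under [t];
    such an edge may have any positive length. *)
Definition adjacent (t : G) : Prop :=
  P t /\ (0 < L t)%Z /\
  forall u, P u -> (L u + L (gmul (ginv u) t) = L t)%Z -> L u = 0%Z \/ L u = L t.

Lemma adjacent_inv t : adjacent t -> adjacent (ginv t).
Proof.
  intros [H1 [H2 H3]]. split; [now apply sub_inv|].
  rewrite (tl_inv P L TL) by assumption. split; [assumption|].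
  intros u Hu E. assert (Hut : P (gmul (ginv u) (ginv t))) by (repeat apply sub_mul; try apply sub_inv; auto).
  assert (Htu : P (gmul t u)) by (apply sub_mul; auto).
  assert (E1 : L (gmul (ginv u) (ginv t)) = L (gmul t u)).
  { rewrite <- (tl_inv P L TL (gmul t u)) by assumption. now rewrite ginv_mul. }
  destruct (H3 (gmul t u)); auto.
  - replace (gmul (ginv (gmul t u)) t) with (ginv u) by grp.
    rewrite (tl_inv P L TL) by assumption. lia.
  - lia.
  - lia.
Qed.

(* Two adjacent steps that do not backtrack add up: the branch point of
   [x^-1] and [y] is an orbit point, hence trivial by adjacency. *)
Lemma adjacent_mul x y : adjacent x -> adjacent y ->
  L (gmul x y) <> 0%Z -> L (gmul x y) = (L x + L y)%Z.
Proof.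
  intros Hx Hy Hne. pose proof (adjacent_inv x Hx) as [A1 [A2 A3]].
  destruct Hx as [X1 [X2 X3]]. destruct Hy as [Y1 [Y2 Y3]].
  destruct (tl_reg P L TL (ginv x) y) as [u [U1 [U2 [U3 U4]]]]; auto.
  rewrite ginv_inv in U2. rewrite (tl_inv P L TL x) in * by assumption.
  destruct (A3 u U1 U3) as [E|E]; [lia|].
  destruct (Y3 u U1 U4) as [E'|E']; [lia|].
  exfalso. apply Hne.
  pose proof (tl_tri P L TL (ginv (gmul (ginv u) (ginv x))) (gmul (ginv u) y)) as HT.
  rewrite (tl_inv P L TL) in HT by (repeat apply sub_mul; try apply sub_inv; auto).
  replace (gmul (ginv (gmul (ginv u) (ginv x))) (gmul (ginv u) y)) with (gmul x y) in HT by grp.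
  pose proof (tl_nonneg P L TL (gmul x y) (sub_mul G P SP _ _ X1 Y1)).
  assert (H1 : P (gmul (ginv u) (ginv x))) by (repeat apply sub_mul; try apply sub_inv; auto).
  assert (H2 : P (gmul (ginv u) y)) by (repeat apply sub_mul; try apply sub_inv; auto).
  specialize (HT (sub_inv G P SP _ H1) H2). lia.
Qed.

(** The four point condition for [x^-1], [y] and [y z] carries additivity across the middle piece
    [y]; its other alternative would give [2 L y <= L y + 0], against [L y > 0]. *)
Lemma no_backtrack_extends x y z : adjacent x -> adjacent y -> P z ->
  L (gmul x y) <> 0%Z -> L (gmul y z) = (L y + L z)%Z ->
  L (gmul x (gmul y z)) = (L x + L (gmul y z))%Z.
Proof.
  intros Hx Hy Hz Hne E. pose proof (adjacent_mul x y Hx Hy Hne) as E2.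
  destruct Hx as [X1 [X2 _]]. destruct Hy as [Y1 [Y2 _]].
  assert (Hyz : P (gmul y z)) by (apply sub_mul; auto).
  assert (HT := tl_tri P L TL x (gmul y z) X1 Hyz).
  destruct (tl_hyp P L TL (ginv x) y (gmul y z)) as [H|H]; auto.
  - now apply sub_inv.
  - rewrite ginv_inv in H. lia.
  - rewrite ginv_inv, gmulKV, (tl_inv P L TL) in H by assumption. lia.
Qed.

Lemma generated_by_adjacent g : P g ->
  exists S T, (forall k, In k S -> K k) /\ (forall t, In t T -> adjacent t) /\ gen (S ++ T) g.
Proof.
  intros Hg. remember (Z.to_nat (L g)) as m eqn:Em. revert g Hg Em.
  induction m as [m IH] using (well_founded_induction lt_wf). intros g Hg Em.
  pose proof (tl_nonneg P L TL g Hg) as H0.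
  destruct (Z.eq_dec (L g) 0) as [E|E].
  { exists [g], []. split; [intros k [<-|[]]; now split|]. split; [intros t []|].
    apply gen_in. now left. }
  destruct (classic (adjacent g)) as [Ha|Ha].
  { exists [], [g]. split; [intros k []|]. split; [intros t [<-|[]]; assumption|].
    apply gen_in. now left. }
  assert (Hu : exists u, P u /\ (L u + L (gmul (ginv u) g) = L g)%Z /\ L u <> 0%Z /\ L u <> L g).
  { apply NNPP. intros Hno. apply Ha. split; [assumption|]. split; [lia|].
    intros u Hu Eu. apply NNPP. intros Hn. apply Hno. exists u. tauto. }
  destruct Hu as [u [Hu [E1 [E2 E3]]]].
  assert (Hug : P (gmul (ginv u) g)) by (apply sub_mul; [|apply sub_inv|]; auto).
  pose proof (tl_nonneg P L TL u Hu). pose proof (tl_nonneg P L TL _ Hug).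
  destruct (IH (Z.to_nat (L u)) ltac:(lia) u Hu eq_refl) as [S1 [T1 [A1 [B1 C1]]]].
  destruct (IH (Z.to_nat (L (gmul (ginv u) g))) ltac:(lia) _ Hug eq_refl) as [S2 [T2 [A2 [B2 C2]]]].
  exists (S1 ++ S2), (T1 ++ T2). split; [|split].
  - intros k Hk. apply in_app_or in Hk. destruct Hk; auto.
  - intros t Ht. apply in_app_or in Ht. destruct Ht; auto.
  - rewrite <- (gmulVK G u g). apply (sub_mul G _ (gen_subgroup G _)).
    + revert C1. apply gen_incl. intros x. rewrite !in_app_iff. tauto.
    + revert C2. apply gen_incl. intros x. rewrite !in_app_iff. tauto.
Qed.

(** * Edge orbits and stable letters *)

Hypothesis no_inversion : forall s, P s -> K (gmul s s) -> K s.

(** Double cosets of [K], identified with those of the inverses because one stable letter serves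
    both orientations of an edge orbit. *)
Definition same_edge (x y : G) : Prop :=
  exists h h', K h /\ K h' /\ (x = gmul h (gmul y h') \/ x = gmul h (gmul (ginv y) h')).

Fixpoint inequivalent (T : list G) : Prop :=
  match T with
  | [] => True
  | t :: T' => (forall t', In t' T' -> ~ same_edge t t') /\ inequivalent T'
  end.

(** A discarded letter is [h t' h'] or [h t'^-1 h']; putting [h] and [h'] into [S] keeps it in the
    generated group. *)
Lemma prune_letters T : (forall t, In t T -> adjacent t) ->
  exists S T', (forall k, In k S -> K k) /\ (forall t, In t T' -> adjacent t) /\
    inequivalent T' /\ forall t, In t T -> gen (S ++ T') t.
Proof.
  induction T as [|t T IH]; intros HT.
  { exists [], []. split; [|split; [|split; [exact I|]]]; intros x []. }
  destruct IH as [S [T' [H1 [H2 [H3 H4]]]]]; [intros x Hx; apply HT; now right|].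
  destruct (classic (exists t', In t' T' /\ same_edge t t')) as [[t' [Ht' [h [h' [Hh [Hh' E]]]]]]|Hno].
  - exists (h :: h' :: S), T'. split; [|split; [assumption|split; [assumption|]]].
    { intros k [<-|[<-|Hk]]; auto. }
    intros x [<-|Hx].
    + set (S' := (h :: h' :: S) ++ T').
      assert (Gh : gen S' h) by (apply gen_in; now left).
      assert (Gh' : gen S' h') by (apply gen_in; right; now left).
      assert (Gt : gen S' t') by (apply gen_in; unfold S'; rewrite in_app_iff; now right).
      pose proof (gen_subgroup G S') as SG.
      destruct E as [-> | ->]; repeat apply (sub_mul G _ SG); auto; now apply (sub_inv G _ SG).
    + apply (gen_incl G (S ++ T')); [|auto]. intros y Hy. now do 2 right.
  - exists S, (t :: T'). split; [assumption|]. split; [|split].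
    + intros x [<-|Hx]; [apply HT; now left|auto].
    + simpl. split; [|assumption]. intros t' Ht' E. apply Hno. eauto.
    + intros x [<-|Hx].
      * apply gen_in, in_app_iff. right. now left.
      * apply (gen_incl G (S ++ T')); [|auto]. intros y. rewrite !in_app_iff. simpl. tauto.
Qed.

Definition letter (t : nat -> G) (i : nat) (b : bool) : G :=
  if b then t i else ginv (t i).

(** The second clause is the input for Britton's lemma: two letters around a base element fall back
    into [K] only when they form a pinch. *)
Definition good_letters (m : nat) (t : nat -> G) : Prop :=
  (forall i, i < m -> adjacent (t i)) /\
  (forall i j b b' h, i < m -> j < m -> K h ->
     K (gmul (letter t i b) (gmul h (letter t j b'))) -> i = j /\ b' = negb b).

Lemma same_edge_sym x y : same_edge x y -> same_edge y x.
Proof.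
  intros [h [h' [Hh [Hh' [-> | ->]]]]].
  - exists (ginv h), (ginv h'). repeat split; try (apply (sub_inv G _ SK); assumption). left. grp.
  - exists h', h. repeat split; try apply Hh; try apply Hh'. right. grp.
Qed.

Lemma inequivalent_nth T i j : inequivalent T -> i < length T -> j < length T ->
  same_edge (nth i T gone) (nth j T gone) -> i = j.
Proof.
  revert i j. induction T as [|t T IH]; intros i j HT Hi Hj E; simpl in *; [lia|].
  destruct HT as [H1 H2].
  destruct i as [|i], j as [|j]; auto.
  - exfalso. apply (H1 (nth j T gone)); [apply nth_In; lia|assumption].
  - exfalso. apply (H1 (nth i T gone)); [apply nth_In; lia|]. now apply same_edge_sym.
  - f_equal. apply IH; auto; lia.
Qed.

Lemma letter_adjacent m t i b : good_letters m t -> i < m -> adjacent (letter t i b).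
Proof.
  intros [H _] Hi. destruct b; simpl; [auto|]. apply adjacent_inv. auto.
Qed.

(** If [s h s] were in [K], so would be the square of [s h], and [s h] would flip its edge. *)
Lemma no_return s h : adjacent s -> K h -> ~ K (gmul s (gmul h s)).
Proof.
  intros [S1 [S2 _]] Hh HK.
  assert (Hsh : P (gmul s h)) by (apply sub_mul; auto; apply Hh).
  assert (E : K (gmul s h)).
  { apply no_inversion; [assumption|].
    replace (gmul (gmul s h) (gmul s h)) with (gmul (gmul s (gmul h s)) h) by grp.
    now apply (sub_mul G _ SK). }
  destruct E as [_ E]. rewrite tree_length_mul_kernel_r in E by assumption. lia.
Qed.

Lemma good_letters_intro T : (forall t, In t T -> adjacent t) -> inequivalent T ->
  good_letters (length T) (fun i => nth i T gone).
Proof.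
  intros HT Hne. set (t := fun i => nth i T gone).
  assert (Ha : forall i, i < length T -> adjacent (t i)) by (intros i Hi; now apply HT, nth_In).
  split; [assumption|]. intros i j b b' h Hi Hj Hh HK.
  (* Solving for the first letter puts [t i] into the double coset of [t j] or of its inverse. *)
  assert (Eij : i = j).
  { apply (inequivalent_nth T); auto.
    set (k := gmul (letter t i b) (gmul h (letter t j b'))) in *.
    assert (E : letter t i b = gmul k (gmul (ginv (letter t j b')) (ginv h)))
      by (unfold k; grp).
    assert (E' : ginv (letter t i b) = gmul h (gmul (letter t j b') (ginv k)))
      by (unfold k; grp).
    change (same_edge (t i) (t j)).
    assert (K (ginv h) /\ K (ginv k)) as [? ?] by (split; now apply (sub_inv G _ SK)).
    destruct b; simpl letter in E, E'.
    - exists k, (ginv h). repeat split; try apply HK; try apply H. destruct b'; simpl letter in E.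
      + now right.
      + left. now rewrite ginv_inv in E.
    - rewrite ginv_inv in E'. exists h, (ginv k). repeat split; try apply Hh; try apply H0.
      destruct b'; simpl letter in E'; [now left|now right]. }
  split; [assumption|]. subst j.
  destruct b, b'; simpl; auto; exfalso.
  - now apply (no_return (t i) h (Ha i Hi) Hh).
  - now apply (no_return (ginv (t i)) h (adjacent_inv _ (Ha i Hi)) Hh).
Qed.

Lemma finitely_many_letters : fin_gen_sub P ->
  exists S T, (forall k, In k S -> K k) /\
    good_letters (length T) (fun i => nth i T gone) /\ forall g, P g -> gen (S ++ T) g.
Proof.
  intros [X [HX1 HX2]].
  assert (H : exists S T, (forall k, In k S -> K k) /\ (forall t, In t T -> adjacent t) /\
     forall x, In x X -> gen (S ++ T) x).
  { clear HX2. induction X as [|x X IH].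
    - exists [], []. split; [|split]; intros x [].
    - destruct IH as [S1 [T1 [A1 [B1 C1]]]]; [intros y Hy; apply HX1; now right|].
      destruct (generated_by_adjacent x) as [S2 [T2 [A2 [B2 C2]]]]; [apply HX1; now left|].
      exists (S1 ++ S2), (T1 ++ T2). split; [|split].
      + intros k Hk. apply in_app_or in Hk. destruct Hk; auto.
      + intros t Ht. apply in_app_or in Ht. destruct Ht; auto.
      + intros y [<-|Hy].
        * revert C2. apply gen_incl. intros z. rewrite !in_app_iff. tauto.
        * generalize (C1 y Hy). apply gen_incl. intros z. rewrite !in_app_iff. tauto. }
  destruct H as [S1 [T1 [A1 [B1 C1]]]].
  destruct (prune_letters T1 B1) as [S2 [T2 [A2 [B2 [C2 D2]]]]].
  exists (S1 ++ S2), T2. split; [|split].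
  - intros k Hk. apply in_app_or in Hk. destruct Hk; auto.
  - now apply good_letters_intro.
  - intros g Hg.
    assert (HS : forall x, gen (S1 ++ T1) x -> gen ((S1 ++ S2) ++ T2) x).
    { apply gen_least; [apply gen_subgroup|]. intros x Hx. apply in_app_or in Hx.
      destruct Hx as [Hx|Hx].
      - apply gen_in. rewrite !in_app_iff. tauto.
      - generalize (D2 x Hx). apply gen_incl. intros z. rewrite !in_app_iff. tauto. }
    assert (HXg : gen X g) by (now apply HX2).
    revert HXg. apply gen_least; [apply gen_subgroup|]. intros x Hx. now apply HS, C1.
Qed.

(** * Normal forms *)

Section NormalForms.
Variables (m : nat) (t : nat -> G).
Hypothesis good : good_letters m t.
Variables (H : Group) (K0 : G -> Prop) (f : G -> H) (s : nat -> H).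
Hypothesis K0_sub : is_subgroup K0.
Hypothesis K0_K : forall h, K0 h -> K h.
Hypothesis f_mul : hom_on K0 f.

Let tau := letter t.
Let sigma (i : nat) (b : bool) : H := if b then s i else ginv (s i).

(** Removing a pinch must be possible on both sides: its value stays in [K0], and its image obeys
    the HNN relation in [H]. *)
Hypothesis conj_closed : forall i b h, i < m -> K0 h ->
  K (gmul (tau i b) (gmul h (tau i (negb b)))) ->
  K0 (gmul (tau i b) (gmul h (tau i (negb b)))) /\
  gmul (sigma i b) (gmul (f h) (sigma i (negb b))) =
    f (gmul (tau i b) (gmul h (tau i (negb b)))).

(* [Red y z]: [y] is the value of a reduced word, and [z] is the value in [H] of
   the same word, under [f] on the base and [s] on the stable letters. *)
Inductive Red : G -> H -> Prop :=
| Red_base h : K0 h -> Red h (f h)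
| Red_step h i b y z : K0 h -> i < m -> Red y z ->
    L (gmul (tau i b) y) = (L (tau i b) + L y)%Z ->
    Red (gmul h (gmul (tau i b) y)) (gmul (f h) (gmul (sigma i b) z)).

Let tau_adj i b (Hi : i < m) : adjacent (tau i b) := letter_adjacent m t i b good Hi.

Lemma Red_in y z : Red y z -> P y.
Proof.
  induction 1 as [h Hh|h i b y z Hh Hi Hr IH E].
  - apply K0_K, Hh.
  - repeat apply sub_mul; auto; [apply K0_K, Hh|apply (tau_adj i b Hi)].
Qed.

(** Britton's lemma: every letter of a reduced word adds positive length, so length zero leaves only
    the base case. *)
Lemma Red_kernel y z : Red y z -> L y = 0%Z -> K0 y /\ z = f y.
Proof.
  intros Hr E. destruct Hr as [h Hh|h i b y z Hh Hi Hr El]; [now split|exfalso].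
  pose proof (Red_in y z Hr) as Hy. destruct (tau_adj i b Hi) as [T1 [T2 _]].
  rewrite tree_length_mul_kernel_l in E by (auto; apply sub_mul; auto).
  pose proof (tl_nonneg P L TL y Hy). lia.
Qed.

Lemma f_one : f gone = gone.
Proof.
  apply (gmul_cancel_l H (f gone)). rewrite <- f_mul by (now apply sub_one).
  now rewrite !gmul1r.
Qed.

Lemma Red_mul_base k y z : K0 k -> Red y z -> Red (gmul k y) (gmul (f k) z).
Proof.
  intros Hk Hr. destruct Hr as [h Hh|h i b y z Hh Hi Hr E].
  - rewrite <- f_mul by assumption. apply Red_base. now apply sub_mul.
  - rewrite gmulA, (gmulA H), <- f_mul by assumption.
    apply Red_step; auto. now apply sub_mul.
Qed.

(** Either the new letter closes a pinch with the first letter of the word, and [conj_closed]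
    removes it, or the two edges do not backtrack and lengths add. *)
Lemma Red_mul_letter i b y z : i < m -> Red y z ->
  Red (gmul (tau i b) y) (gmul (sigma i b) z).
Proof.
  intros Hi Hr.
  assert (Hstep : L (gmul (tau i b) y) = (L (tau i b) + L y)%Z ->
    Red (gmul (tau i b) y) (gmul (sigma i b) z)).
  { intros E. rewrite <- (gmul1l G (gmul (tau i b) y)), <- (gmul1l H (gmul (sigma i b) z)), <- f_one.
    apply Red_step; auto. now apply sub_one. }
  destruct (tau_adj i b Hi) as [T1 [T2 T3]].
  destruct Hr as [h Hh|h j b' y z Hh Hj Hr E].
  { apply Hstep. rewrite tree_length_mul_kernel_r by auto.
    destruct (K0_K h Hh) as [_ ->]. lia. }
  pose proof (Red_in y z Hr) as Hy. destruct (tau_adj j b' Hj) as [T1' [T2' T3']].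
  destruct (Z.eq_dec (L (gmul (tau i b) (gmul h (tau j b')))) 0) as [E0|E0].
  - assert (HK : K (gmul (tau i b) (gmul h (tau j b')))).
    { split; [|assumption]. repeat apply sub_mul; auto. apply K0_K, Hh. }
    destruct (proj2 good i j b b' h Hi Hj (K0_K h Hh) HK) as [<- ->].
    destruct (conj_closed i b h Hi Hh HK) as [C1 C2].
    replace (gmul (tau i b) (gmul h (gmul (tau i (negb b)) y)))
      with (gmul (gmul (tau i b) (gmul h (tau i (negb b)))) y) by grp.
    replace (gmul (sigma i b) (gmul (f h) (gmul (sigma i (negb b)) z)))
      with (gmul (gmul (sigma i b) (gmul (f h) (sigma i (negb b)))) z) by grp.
    rewrite C2. now apply Red_mul_base.
  - apply Hstep.
    (* The base factor [h] is absorbed into the next letter, so that two adjacent elements meet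
       directly. *)
    assert (Hha : adjacent (gmul h (tau j b'))).
    { pose proof (K0_K h Hh) as Hk. split; [apply sub_mul; auto; apply Hk|].
      rewrite tree_length_mul_kernel_l by auto. split; [assumption|].
      intros u Hu Eu. pose proof (sub_inv G _ SK _ Hk) as Hk'.
      rewrite <- (tree_length_mul_kernel_l (ginv h) u) in Eu |- * by auto.
      apply T3'; [apply sub_mul; auto; apply Hk'|].
      rewrite <- Eu. do 2 f_equal. grp. }
    rewrite (gmulA G h (tau j b') y).
    apply no_backtrack_extends; [exact (tau_adj i b Hi)|exact Hha|exact Hy|exact E0|].
    rewrite gmulA_r, !(tree_length_mul_kernel_l h); auto. apply sub_mul; auto.
Qed.

Lemma Red_mul y z y' z' : Red y z -> Red y' z' -> Red (gmul y y') (gmul z z').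
Proof.
  intros Hr Hr'. induction Hr as [h Hh|h i b y z Hh Hi Hr IH E].
  - now apply Red_mul_base.
  - rewrite !gmulA_r. apply Red_mul_base; [assumption|]. now apply Red_mul_letter.
Qed.

Lemma Red_one : Red gone gone.
Proof. rewrite <- f_one. apply Red_base. now apply sub_one. Qed.

Lemma Red_letter i b : i < m -> Red (tau i b) (sigma i b).
Proof.
  intros Hi. rewrite <- (gmul1r G (tau i b)), <- (gmul1r H (sigma i b)).
  apply Red_mul_letter; [assumption|apply Red_one].
Qed.

Lemma Red_inv y z : Red y z -> Red (ginv y) (ginv z).
Proof.
  intros Hr. induction Hr as [h Hh|h i b y z Hh Hi Hr IH E].
  - replace (ginv (f h)) with (f (ginv h)); [apply Red_base; now apply sub_inv|].
    apply ginv_unique. rewrite <- f_mul; [rewrite gmulVr; apply f_one|assumption|now apply sub_inv].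
  - rewrite !ginv_mul.
    assert (Hh' : Red (ginv h) (ginv (f h))).
    { replace (ginv (f h)) with (f (ginv h)); [apply Red_base; now apply sub_inv|].
      apply ginv_unique. rewrite <- f_mul; [rewrite gmulVr; apply f_one|assumption|now apply sub_inv]. }
    apply Red_mul; [apply Red_mul; [assumption|]|assumption].
    pose proof (Red_letter i (negb b) Hi) as Hl. destruct b; simpl in *; [exact Hl|].
    now rewrite !ginv_inv.
Qed.

(** The quotient of two values of [y] is a value of [gone], which [Red_kernel] identifies as
    [f gone]. *)
Lemma Red_functional y z z' : Red y z -> Red y z' -> z = z'.
Proof.
  intros H1 H2. pose proof (Red_mul _ _ _ _ (Red_inv _ _ H1) H2) as H3.
  rewrite gmulVl in H3. destruct (Red_kernel _ _ H3 (tl_one P L TL)) as [_ E].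
  rewrite f_one in E. apply ginv_unique in E. rewrite E. now rewrite ginv_inv.
Qed.

Lemma Red_total (S : list G) g :
  (forall k, In k S -> K0 k \/ exists i, i < m /\ k = t i) -> gen S g -> exists z, Red g z.
Proof.
  intros HS. apply (gen_least G S (fun g => exists z, Red g z)).
  - split; [|split].
    + exists gone. apply Red_one.
    + intros x y [z Hz] [z' Hz']. exists (gmul z z'). now apply Red_mul.
    + intros x [z Hz]. exists (ginv z). now apply Red_inv.
  - intros k Hk. destruct (HS k Hk) as [Hk0|[i [Hi ->]]].
    + exists (f k). now apply Red_base.
    + exists (s i). exact (Red_letter i true Hi).
Qed.
End NormalForms.

(** With [K0 = K], totality and functionality make [Red] the graph of the required homomorphism;
    uniqueness comes from generation. *)
Lemma letters_HNN (S T : list G) : (forall k, In k S -> K k) ->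
  good_letters (length T) (fun i => nth i T gone) -> (forall g, P g -> gen (S ++ T) g) ->
  is_HNN_extension P K (length T)
    (fun i a => K a /\ K (gmul (gmul (nth i T gone) a) (ginv (nth i T gone))))
    (fun i b => K b /\ K (gmul (gmul (ginv (nth i T gone)) b) (nth i T gone)))
    (fun i a => gmul (gmul (nth i T gone) a) (ginv (nth i T gone)))
    (fun x => x) (fun i => nth i T gone).
Proof.
  intros HS good Hgen. set (t := fun i => nth i T gone) in *.
  assert (Ht : forall i, i < length T -> P (t i)) by (intros i Hi; apply (proj1 good i Hi)).
  split; [exact SP|]. split; [exact SK|].
  split; [|split; [|split; [|split; [|split]]]].
  - intros i Hi. fold (t i). split; [|split; [|split; [|split; [|split; [|split; [|split]]]]]].
    + split; [|split].
      * split; [now apply (sub_one G _ SK)|]. replace (gmul (gmul (t i) gone) (ginv (t i))) with (@gone G) by grp.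
        now apply (sub_one G _ SK).
      * intros x y [X1 X2] [Y1 Y2]. split; [now apply (sub_mul G _ SK)|].
        replace (gmul (gmul (t i) (gmul x y)) (ginv (t i))) with
          (gmul (gmul (gmul (t i) x) (ginv (t i))) (gmul (gmul (t i) y) (ginv (t i)))) by grp.
        now apply (sub_mul G _ SK).
      * intros x [X1 X2]. split; [now apply (sub_inv G _ SK)|].
        replace (gmul (gmul (t i) (ginv x)) (ginv (t i))) with
          (ginv (gmul (gmul (t i) x) (ginv (t i)))) by grp.
        now apply (sub_inv G _ SK).
    + split; [|split].
      * split; [now apply (sub_one G _ SK)|]. replace (gmul (gmul (ginv (t i)) gone) (t i)) with (@gone G) by grp.
        now apply (sub_one G _ SK).
      * intros x y [X1 X2] [Y1 Y2]. split; [now apply (sub_mul G _ SK)|].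
        replace (gmul (gmul (ginv (t i)) (gmul x y)) (t i)) with
          (gmul (gmul (gmul (ginv (t i)) x) (t i)) (gmul (gmul (ginv (t i)) y) (t i))) by grp.
        now apply (sub_mul G _ SK).
      * intros x [X1 X2]. split; [now apply (sub_inv G _ SK)|].
        replace (gmul (gmul (ginv (t i)) (ginv x)) (t i)) with
          (ginv (gmul (gmul (ginv (t i)) x) (t i))) by grp.
        now apply (sub_inv G _ SK).
    + intros a [Ha _]; exact Ha.
    + intros b [Hb _]; exact Hb.
    + intros x y _ _. grp.
    + intros a [A1 A2]. split; [exact A2|].
      replace (gmul (gmul (ginv (t i)) (gmul (gmul (t i) a) (ginv (t i)))) (t i)) with a by grp.
      exact A1.
    + intros a a' _ _ E.
      replace a with (gmul (ginv (t i)) (gmul (gmul (gmul (t i) a) (ginv (t i))) (t i))) by grp.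
      rewrite E. grp.
    + intros b [B1 B2]. exists (gmul (gmul (ginv (t i)) b) (t i)).
      assert (E : gmul (gmul (t i) (gmul (gmul (ginv (t i)) b) (t i))) (ginv (t i)) = b) by grp.
      rewrite E. repeat split; try apply B1; apply B2.
  - intros x y _ _; reflexivity.
  - intros x Hx; apply Hx.
  - exact Ht.
  - intros i a _ _; reflexivity.
  - intros H f s Hf Hs.
    assert (Hin : forall k, In k (S ++ T) -> K k \/ exists i, i < length T /\ k = t i).
    { intros k Hk. apply in_app_or in Hk. destruct Hk as [Hk|Hk]; [now left; apply HS|].
      right. destruct (In_nth T k gone Hk) as [i [Hi E]]. exists i. now split. }
    assert (Hconj : forall i b h, i < length T -> K h ->
      K (gmul (letter t i b) (gmul h (letter t i (negb b)))) ->
      K (gmul (letter t i b) (gmul h (letter t i (negb b)))) /\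
      gmul (if b then s i else ginv (s i)) (gmul (f h) (if negb b then s i else ginv (s i))) =
      f (gmul (letter t i b) (gmul h (letter t i (negb b))))).
    { intros i b h Hi Hh HK. split; [assumption|]. destruct b; simpl in *.
      - rewrite !gmulA in *. rewrite Hs; [reflexivity|assumption|]. now split.
      - set (a := gmul (ginv (t i)) (gmul h (t i))) in *.
        assert (E : gmul (gmul (t i) a) (ginv (t i)) = h) by (unfold a; grp).
        assert (Hsa : gmul (gmul (s i) (f a)) (ginv (s i)) = f (gmul (gmul (t i) a) (ginv (t i)))).
        { apply Hs; [assumption|]. split; [assumption|]. change (nth i T gone) with (t i). now rewrite E. }
        rewrite E in Hsa. rewrite <- Hsa. grp. }
    set (R := Red (length T) t H K f s).
    split.
    + assert (Hex : forall y, exists z, P y -> R y z).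
      { intros y. destruct (classic (P y)) as [Hy|Hy]; [|exists gone; tauto].
        destruct (Red_total (length T) t good H K f s SK (fun h Hh => Hh) Hf Hconj (S ++ T) y Hin (Hgen y Hy))
          as [z Hz]. now exists z. }
      set (F := fun y => proj1_sig (constructive_indefinite_description _ (Hex y))).
      assert (HF : forall y, P y -> R y (F y))
        by (intros y; exact (proj2_sig (constructive_indefinite_description _ (Hex y)))).
      assert (Hfun : forall y z z', R y z -> R y z' -> z = z')
        by (exact (Red_functional (length T) t good H K f s SK (fun h Hh => Hh) Hf Hconj)).
      exists F. split; [|split].
      * intros x y Hx Hy. apply (Hfun (gmul x y)); [apply HF; now apply sub_mul|].
        apply (Red_mul (length T) t good H K f s SK (fun h Hh => Hh) Hf Hconj); auto; now apply HF.
      * intros x Hx. apply (Hfun x); [apply HF, Hx|]. now apply Red_base.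
      * intros i Hi. apply (Hfun (t i)); [now apply HF, Ht|].
        exact (Red_letter (length T) t good H K f s SK (fun h Hh => Hh) Hf Hconj i true Hi).
    + intros F1 F2 H1 H2 EK Et y Hy.
      assert (HQ : forall y, gen (S ++ T) y -> P y /\ F1 y = F2 y); [|now apply HQ, Hgen].
      assert (Hone : forall F : G -> H, hom_on P F -> F gone = gone).
      { intros F HF. apply (gmul_cancel_l H (F gone)).
        rewrite <- HF by (now apply sub_one). now rewrite !gmul1r. }
      apply gen_least; [split; [|split]|].
      * split; [now apply sub_one|]. now rewrite !Hone.
      * intros x x' [A1 A2] [B1 B2]. split; [now apply sub_mul|].
        rewrite H1, H2 by assumption. congruence.
      * intros x [A1 A2]. assert (A3 : P (ginv x)) by (now apply sub_inv).
        split; [assumption|]. apply (gmul_cancel_l H (F1 x)). rewrite A2 at 2.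
        rewrite <- H1, <- H2 by assumption. rewrite gmulVr. now rewrite !Hone.
      * intros k Hk. destruct (Hin k Hk) as [Hk'|[i [Hi ->]]].
        -- split; [apply Hk'|]. now apply EK.
        -- split; [now apply Ht|]. now apply Et.
Qed.

(** Let [K0] be generated by [S] and by generators of both edge groups of each letter. Pinches then
    stay in [K0], so every element of [K] has a reduced word over [K0], necessarily without
    letters. *)
Lemma base_fin_gen : fin_gen_sub P ->
  (forall t, P t -> (0 < L t)%Z -> fin_gen_sub (fun a => K a /\ K (gmul (ginv t) (gmul a t)))) ->
  fin_gen_sub K.
Proof.
  intros HP HA. destruct (finitely_many_letters HP) as [S [T [HS [good Hgen]]]].
  set (t := fun i => nth i T gone) in *.
  assert (HE : exists E, (forall k, In k E -> K k) /\
    forall i b a, i < length T -> K a -> K (gmul (ginv (letter t i b)) (gmul a (letter t i b))) -> gen E a).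
  { assert (HE : forall m, m <= length T -> exists E, (forall k, In k E -> K k) /\
      forall i b a, i < m -> K a -> K (gmul (ginv (letter t i b)) (gmul a (letter t i b))) -> gen E a);
      [|now apply HE].
    induction m as [|m IH]; intros Hm.
    - exists []. split; [intros k []|intros; lia].
    - destruct IH as [E [E1 E2]]; [lia|].
      assert (Ha : forall b, adjacent (letter t m b)) by (intros b; apply (letter_adjacent (length T) t m b good); lia).
      destruct (HA (letter t m true)) as [X [X1 X2]]; try apply Ha.
      destruct (HA (letter t m false)) as [Y [Y1 Y2]]; try apply Ha.
      exists (X ++ Y ++ E). split.
      + intros k Hk. rewrite !in_app_iff in Hk. destruct Hk as [Hk|[Hk|Hk]]; auto; [apply (X1 k Hk)|apply (Y1 k Hk)].
      + intros i b a Hi Ka Hc. destruct (Nat.eq_dec i m) as [->|Hne].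
        * destruct b.
          -- apply (gen_incl G X); [intros x; rewrite !in_app_iff; tauto|]. apply X2. now split.
          -- apply (gen_incl G Y); [intros x; rewrite !in_app_iff; tauto|]. apply Y2. now split.
        * apply (gen_incl G E); [intros x; rewrite !in_app_iff; tauto|].
          apply (E2 i b); auto. lia. }
  destruct HE as [E [E1 E2]].
  set (K0 := gen (S ++ E)).
  assert (K0_sub : is_subgroup K0) by apply gen_subgroup.
  assert (HSE : forall x, In x (S ++ E) -> K x).
  { intros x Hx. apply in_app_or in Hx. destruct Hx; auto. }
  assert (K0_K : forall h, K0 h -> K h) by (now apply gen_least).
  apply (fin_gen_sub_intro G (S ++ E)); [assumption|].
  intros g Hg.
  assert (Hconj : forall i b h, i < length T -> K0 h ->
      K (gmul (letter t i b) (gmul h (letter t i (negb b)))) ->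
      K0 (gmul (letter t i b) (gmul h (letter t i (negb b)))) /\
      gmul (if b then (fun _ => @gone trivial_group) i else ginv ((fun _ => @gone trivial_group) i))
        (gmul ((fun _ => @gone trivial_group) h)
           (if negb b then (fun _ => @gone trivial_group) i else ginv ((fun _ => @gone trivial_group) i))) =
      (fun _ => @gone trivial_group) (gmul (letter t i b) (gmul h (letter t i (negb b))))).
  { intros i b h Hi Hh HK. split; [|destruct b; reflexivity].
    apply (gen_incl G E); [intros x; rewrite in_app_iff; tauto|].
    apply (E2 i b); auto.
    replace (gmul (ginv (letter t i b)) (gmul (gmul (letter t i b) (gmul h (letter t i (negb b)))) (letter t i b)))
      with h by (destruct b; simpl; grp).
    now apply K0_K. }
  assert (Hf : hom_on K0 (fun _ : G => @gone trivial_group)) by (intros x y _ _; reflexivity).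
  destruct (Red_total (length T) t good trivial_group K0 _ _ K0_sub K0_K Hf Hconj (S ++ T) g) as [z Hz].
  - intros k Hk. apply in_app_or in Hk. destruct Hk as [Hk|Hk].
    + left. apply gen_in, in_app_iff. now left.
    + right. destruct (In_nth T k gone Hk) as [i [Hi Ei]]. exists i. now split.
  - apply Hgen, Hg.
  - apply (Red_kernel (length T) t good trivial_group K0 _ _ K0_K g z Hz), Hg.
Qed.
End Tree.

(** * The metric of a hyperbolic length function *)

Definition dist {G : Group} (l : G -> vec) (x y : G) : vec := l (gmul (ginv x) y).

Lemma dist_mul (G : Group) (l : G -> vec) (g x y : G) :
  dist l (gmul g x) (gmul g y) = dist l x y.
Proof. unfold dist. f_equal. grp. Qed.

Lemma dist_one (G : Group) (l : G -> vec) (x : G) : dist l gone x = l x.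
Proof. unfold dist. f_equal. grp. Qed.

Section Metric.
Variables (G : Group) (n : nat) (l : G -> vec) (delta : vec) (d : Z).
Hypothesis Hdelta : veq n delta (kv d).
Hypothesis Hl : length_function n l.
Hypothesis Hhyp : hyperbolic_lf n l delta.
Hypothesis Hreg : regular_lf n l delta.
Hypothesis Hprop : proper_lf n l.

Local Notation "x <=v y" := (vle n x y) (at level 70).
Local Notation "x +v y" := (vadd x y) (at level 50, left associativity).
Local Notation D := (dist l).

Lemma l_one : veq n (l gone) vzero.
Proof. apply Hl. Qed.

Lemma l_nonneg g : vzero <=v l g.
Proof. apply Hl. Qed.

Lemma l_inv g : veq n (l (ginv g)) (l g).
Proof. apply Hl. Qed.

Lemma l_mul g h : l (gmul g h) <=v l g +v l h.
Proof. apply Hl. Qed.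

Lemma dist_sym x y : veq n (D x y) (D y x).
Proof.
  unfold dist. replace (gmul (ginv x) y) with (ginv (gmul (ginv y) x)) by grp. apply l_inv.
Qed.

Lemma dist_to_one x : veq n (D x gone) (l x).
Proof. rewrite <- (dist_one G l x). apply dist_sym. Qed.

(** Left translation moves the base point of the hyperbolicity inequality to [w]; doubling the
    products doubles [delta]. *)
Lemma four_points w x y z :
  D x y +v D w z <=v D x z +v D w y +v kv (2 * d) \/
  D x y +v D w z <=v D y z +v D w x +v kv (2 * d).
Proof.
  pose proof (Hhyp (gmul (ginv w) x) (gmul (ginv w) y) (gmul (ginv w) z)) as H.
  unfold c2 in H.
  fold (D w x) (D w y) (D w z) in H.
  change (l (gmul (ginv (gmul (ginv w) x)) (gmul (ginv w) z))) with (D (gmul (ginv w) x) (gmul (ginv w) z)) in H.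
  change (l (gmul (ginv (gmul (ginv w) y)) (gmul (ginv w) z))) with (D (gmul (ginv w) y) (gmul (ginv w) z)) in H.
  change (l (gmul (ginv (gmul (ginv w) x)) (gmul (ginv w) y))) with (D (gmul (ginv w) x) (gmul (ginv w) y)) in H.
  rewrite !dist_mul in H.
  pose proof (kv_scale n 2 d) as E.
  match type of H with vle _ (vsub (vmin _ ?a ?b) _) ?c =>
    assert (H' : vmin n a b <=v c +v vscale 2 delta) by vlia end.
  apply vmin_cases in H'. clear H. destruct H' as [H|H]; [left|right]; vlia.
Qed.

Lemma Gk_iff k g : Gk n l k g <-> forall i, k < i <= n -> l g i = 0%Z.
Proof. apply ht_le_iff. Qed.

Lemma Gk_le k g h : Gk n l k h -> l g <=v l h -> Gk n l k g.
Proof.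
  rewrite !Gk_iff. intros Hh Hle. apply (nonneg_le_coord0 n (l g) (l h)); auto. apply l_nonneg.
Qed.

Lemma Gk_subgroup k : is_subgroup (Gk n l k).
Proof.
  split; [|split].
  - apply Gk_iff. intros i Hi. rewrite l_one by lia. reflexivity.
  - intros x y. rewrite !Gk_iff. intros Hx Hy.
    apply (nonneg_le_coord0 n _ (l x +v l y)); [apply l_nonneg|apply l_mul|].
    intros i Hi. unfold vadd. rewrite Hx, Hy by lia. reflexivity.
  - intros x. rewrite !Gk_iff. intros Hx i Hi. rewrite l_inv by lia. auto.
Qed.

(** The error sits in coordinate 1, strictly below [S k], and so disappears from the comparison of
    top coordinates. *)
Lemma Gk_top_le k a b c : (forall i, S k < i <= n -> a i = 0%Z /\ b i = 0%Z) ->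
  1 <= k < n -> a <=v b +v kv c -> (a (S k) <= b (S k))%Z.
Proof.
  intros Hab Hk Hle.
  assert (H : (a (S k) <= (b +v kv c) (S k))%Z).
  { apply (vle_coord n); [assumption|lia|]. intros i Hi. destruct (Hab i) as [-> E]; [lia|].
    unfold vadd. rewrite E, kv_coord by lia. reflexivity. }
  unfold vadd in H. rewrite kv_coord in H by lia. lia.
Qed.

Lemma tree_length_top k : 1 <= k < n -> tree_length (Gk n l (S k)) (fun g => l g (S k)).
Proof.
  intros Hk.
  assert (SP := Gk_subgroup (S k)).
  assert (HP : forall g, Gk n l (S k) g -> forall i, S k < i <= n -> l g i = 0%Z)
    by (intros g Hg; now apply Gk_iff).
  assert (Hmul : forall g h, Gk n l (S k) g -> Gk n l (S k) h -> Gk n l (S k) (gmul (ginv g) h)).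
  { intros g h Hg Hh. apply sub_mul; auto. now apply sub_inv. }
  split.
  - exact SP.
  - rewrite l_one by lia. reflexivity.
  - intros g Hg. pose proof (vle_coord n vzero (l g) (S k) (l_nonneg g)) as H.
    apply H; [lia|]. intros i Hi. rewrite HP by auto. reflexivity.
  - intros g Hg. apply l_inv. lia.
  - intros g h Hg Hh. change (l g (S k) + l h (S k))%Z with ((l g +v l h) (S k)).
    apply (vle_coord n); [apply l_mul|lia|]. intros i Hi. unfold vadd.
    rewrite !HP; auto. now apply sub_mul.
  - intros f g h Hf Hg Hh. pose proof (four_points gone f g h) as H.
    rewrite !dist_one in H. unfold dist in H.
    destruct H as [H|H]; [left|right].
    + apply (Gk_top_le k _ (l (gmul (ginv f) h) +v l g)) in H; [exact H| |lia].
      intros i Hi. unfold vadd. rewrite !HP; auto.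
    + apply (Gk_top_le k _ (l (gmul (ginv g) h) +v l f)) in H; [exact H| |lia].
      intros i Hi. unfold vadd. rewrite !HP; auto.
  - intros g h Hg Hh. destruct (Hreg g h) as [u [v [gd [hd [E1 [E2 [[-> E3] [[-> E4] E5]]]]]]]].
    assert (Hu : Gk n l (S k) u).
    { apply (Gk_le (S k) u (gmul u gd)); [assumption|]. pose proof (l_nonneg gd). vlia. }
    assert (Hv : Gk n l (S k) v).
    { apply (Gk_le (S k) v (gmul v hd)); [assumption|]. pose proof (l_nonneg hd). vlia. }
    exists u. split; [assumption|]. specialize (E1 (S k) ltac:(lia)). specialize (E2 (S k) ltac:(lia)).
    specialize (E3 (S k) ltac:(lia)). specialize (E4 (S k) ltac:(lia)).
    unfold c2, vscale, vadd, vsub in E1, E2, E3, E4.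
    split; [exact E1|]. split; [rewrite gmulKV; lia|].
    (* The branch points [u] and [v] differ by at most [4 delta], which coordinate [S k] does not
       see, so [u] also serves [h]. *)
    assert (H1 : l (gmul (ginv u) (gmul v hd)) <=v l hd +v kv (4 * d)).
    { pose proof (l_mul (gmul (ginv u) v) hd) as H. rewrite gmulA_r in H.
      pose proof (kv_scale n 4 d). vlia. }
    assert (H2 : l hd <=v l (gmul (ginv u) (gmul v hd)) +v kv (4 * d)).
    { pose proof (l_mul (ginv (gmul (ginv u) v)) (gmul (ginv u) (gmul v hd))) as H.
      replace (gmul (ginv (gmul (ginv u) v)) (gmul (ginv u) (gmul v hd))) with hd in H by grp.
      pose proof (l_inv (gmul (ginv u) v)). pose proof (kv_scale n 4 d). vlia. }
    assert (Hhd : Gk n l (S k) hd) by (rewrite <- (gmulKV G v hd); apply Hmul; auto).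
    assert (Huh : Gk n l (S k) (gmul (ginv u) (gmul v hd))) by (apply Hmul; auto).
    apply (Gk_top_le k) in H1; [|now split; apply HP|lia].
    apply (Gk_top_le k) in H2; [|now split; apply HP|lia]. lia.
Qed.

Lemma Gk_kernel k g : 1 <= k < n ->
  Gk n l k g <-> Gk n l (S k) g /\ l g (S k) = 0%Z.
Proof.
  intros Hk. rewrite !Gk_iff. split.
  - intros H. split; [intros i Hi|]; apply H; lia.
  - intros [H1 H2] i Hi. destruct (Nat.eq_dec i (S k)) as [->|]; [assumption|]. apply H1. lia.
Qed.

(** * Edge stabilizers *)

Hypothesis Hn : 1 <= n.
Hypothesis Hd : (0 < d)%Z.

Section Edge.
Variables (k : nat) (t : G).
Hypothesis Hk : 1 <= k < n.
Hypothesis Ht : Gk n l (S k) t.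
Hypothesis Ht0 : ~ Gk n l k t.

Let K := Gk n l k.
Let A (a : G) : Prop := K a /\ K (gmul (ginv t) (gmul a t)).
Let SK : is_subgroup K := Gk_subgroup k.
Let TLk := tree_length_top k Hk.

Lemma edge_subgroup : is_subgroup A.
Proof.
  split; [|split].
  - split; [now apply (sub_one G)|]. replace (gmul (ginv t) (gmul gone t)) with (@gone G) by grp.
    now apply (sub_one G).
  - intros x y [X1 X2] [Y1 Y2]. split; [now apply (sub_mul G)|].
    replace (gmul (ginv t) (gmul (gmul x y) t)) with
      (gmul (gmul (ginv t) (gmul x t)) (gmul (ginv t) (gmul y t))) by grp.
    now apply (sub_mul G).
  - intros x [X1 X2]. split; [now apply (sub_inv G)|].
    replace (gmul (ginv t) (gmul (ginv x) t)) with (ginv (gmul (ginv t) (gmul x t))) by grp.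
    now apply (sub_inv G).
Qed.

Let SA := edge_subgroup.

Lemma K_up g : K g -> Gk n l (S k) g /\ l g (S k) = 0%Z.
Proof. apply Gk_kernel. assumption. Qed.

Lemma top_cross x y : K x -> K (gmul (ginv t) y) ->
  Gk n l (S k) (gmul (ginv x) y) /\ l (gmul (ginv x) y) (S k) = l t (S k).
Proof.
  intros Hx Hy. replace (gmul (ginv x) y) with (gmul (ginv x) (gmul t (gmul (ginv t) y))) by grp.
  assert (H : forall g, K g -> Gk n l (S k) g) by (intros g Hg; now apply K_up).
  assert (SP := tl_sub _ _ TLk).
  assert (Hxi : K (ginv x)) by (now apply (sub_inv G)).
  assert (Hty : Gk n l (S k) (gmul t (gmul (ginv t) y))) by (apply (sub_mul G); auto).
  split; [apply (sub_mul G); auto|].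
  rewrite (tree_length_mul_kernel_l G _ _ TLk (ginv x)) by (auto; now apply K_up).
  apply (tree_length_mul_kernel_r G _ _ TLk); [now apply K_up|assumption].
Qed.

Lemma t_top_pos : (0 < l t (S k))%Z.
Proof.
  pose proof (tl_nonneg _ _ TLk t Ht) as H. simpl in H.
  destruct (Z.eq_dec (l t (S k)) 0) as [E|E]; [|lia].
  exfalso. apply Ht0. apply Gk_kernel; auto.
Qed.

(* Of the three pairings of two points on each side of the edge, the two that
   cross it twice are higher than the third, so they differ by at most [2 delta]. *)
Lemma cross x x' y y' : K x -> K x' -> K (gmul (ginv t) y) -> K (gmul (ginv t) y') ->
  D x y +v D x' y' <=v D x y' +v D x' y +v kv (2 * d).
Proof.
  intros Hx Hx' Hy Hy'.
  destruct (four_points x' x y y') as [H|H].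
  { pose proof (dist_sym x y). vlia. }
  exfalso.
  assert (Hyy : K (gmul (ginv y) y')).
  { replace (gmul (ginv y) y') with (gmul (ginv (gmul (ginv t) y)) (gmul (ginv t) y')) by grp.
    apply (sub_mul G); auto. now apply (sub_inv G). }
  assert (Hxx : K (gmul (ginv x') x)) by (apply (sub_mul G); auto; now apply (sub_inv G)).
  destruct (top_cross x y Hx Hy) as [C1 C2]. destruct (top_cross x' y' Hx' Hy') as [C3 C4].
  destruct (K_up _ Hyy) as [C5 C6]. destruct (K_up _ Hxx) as [C7 C8].
  rewrite Gk_iff in C1, C3, C5, C7.
  apply (Gk_top_le k) in H; [|intros i Hi; unfold vadd, dist; rewrite C1, C3, C5, C7 by lia; now split|lia].
  unfold vadd, dist in H. rewrite C2, C4, C6, C8 in H. pose proof t_top_pos. lia.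
Qed.

Let tau (a : G) : vec := vsub (D a t) (l t).

Lemma A_inv_t a : A a -> K (gmul (ginv t) (gmul (ginv a) t)).
Proof. intros Ha. exact (proj2 (sub_inv G A SA a Ha)). Qed.

Lemma t_in : K (gmul (ginv t) t).
Proof. rewrite gmulVl. now apply (sub_one G). Qed.

(** After translation by [a^-1], [cross] applies to [x], [gone] on one side and [a^-1 t], [t] on the
    other: the shift measured at [x] is the one at the base point up to [2 delta]. *)
Lemma tau_shift a x : A a -> K x ->
  D (gmul a x) t <=v D x t +v tau a +v kv (2 * d) /\
  D x t +v tau a <=v D (gmul a x) t +v kv (2 * d).
Proof.
  intros Ha Hx.
  assert (E : D (gmul a x) t = D x (gmul (ginv a) t)).
  { rewrite <- (dist_mul G l a x (gmul (ginv a) t)). now rewrite gmulVK. }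
  assert (E' : D a t = D gone (gmul (ginv a) t)).
  { rewrite <- (dist_mul G l a gone (gmul (ginv a) t)). now rewrite gmulVK, gmul1r. }
  rewrite E. unfold tau. rewrite E', <- (dist_one G l t).
  assert (H1 : K gone) by (now apply (sub_one G)).
  pose proof (cross x gone (gmul (ginv a) t) t Hx H1 (A_inv_t a Ha) t_in).
  pose proof (cross x gone t (gmul (ginv a) t) Hx H1 t_in (A_inv_t a Ha)).
  split; vlia.
Qed.

Lemma tau_mul a b : A a -> A b ->
  tau (gmul a b) <=v tau a +v tau b +v kv (2 * d) /\
  tau a +v tau b <=v tau (gmul a b) +v kv (2 * d).
Proof.
  intros Ha Hb. destruct (tau_shift a b Ha (proj1 Hb)) as [H1 H2].
  unfold tau in *. split; vlia.
Qed.

Definition tau_bounded (M : Z) (a : G) : Prop := tau a <=v kv M /\ kv (- M) <=v tau a.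

(** Regularity seen from [t]: [q] is the branch point, on the segment from [t] to [gone], of the
    segments from [t] to [gone] and to [c]. It stays in [K] because crossing distances share their
    top coordinate. *)
Lemma merging_point c : A c -> exists q, K q /\
  veq n (vscale 2 (l q)) (vsub (l c) (tau c)) /\ veq n (l q +v D q t) (l t).
Proof.
  intros Hc. destruct (Hreg (ginv t) (gmul (ginv t) c)) as [u [v [gd [hd [E1 [_ [[E2 E3] _]]]]]]].
  unfold c2 in E1. rewrite ginv_inv, gmulVK in E1.
  exists (gmul t u).
  assert (Hq : veq n (l (gmul t u)) (l gd)).
  { replace (gmul t u) with (ginv gd) by (rewrite <- (ginv_inv G t), E2; grp). apply l_inv. }
  assert (Hqt : veq n (D (gmul t u) t) (l u)).
  { unfold dist. replace (gmul (ginv (gmul t u)) t) with (ginv u) by grp. apply l_inv. }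
  assert (Hct : veq n (l (gmul (ginv t) c)) (D c t)).
  { unfold dist. replace (gmul (ginv t) c) with (ginv (gmul (ginv c) t)) by grp. apply l_inv. }
  pose proof (l_inv t) as Hti.
  assert (E : veq n (vscale 2 (l (gmul t u))) (vsub (l c) (tau c))).
  { intros i Hi. specialize (E1 i Hi). specialize (E3 i Hi). specialize (Hq i Hi).
    specialize (Hqt i Hi). specialize (Hct i Hi). specialize (Hti i Hi).
    unfold tau, vscale, vsub, vadd in *. lia. }
  split; [|split; [exact E|]].
  - apply Gk_iff. intros i Hi. specialize (E i ltac:(lia)). unfold vscale, vsub, tau, vsub in E.
    pose proof (proj1 (Gk_iff _ _) (proj1 Hc) i Hi) as E0.
    assert (E' : D c t i = l t i).
    { destruct (top_cross c t (proj1 Hc) t_in) as [C1 C2].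
      destruct (Nat.eq_dec i (S k)) as [->|Hne]; [exact C2|].
      unfold dist. rewrite Gk_iff in C1. rewrite C1 by lia.
      symmetry. apply (proj1 (Gk_iff _ _) Ht). lia. }
    lia.
  - intros i Hi. specialize (E1 i Hi). specialize (E3 i Hi). specialize (Hq i Hi).
    specialize (Hqt i Hi). specialize (Hct i Hi). specialize (Hti i Hi).
    unfold tau, vscale, vsub, vadd in *. lia.
Qed.

Lemma max_length (F : list G) : F <> [] -> exists c, In c F /\ forall x, In x F -> l x <=v l c.
Proof.
  induction F as [|x F IH]; intros HF; [congruence|].
  destruct F as [|y F].
  - exists x. split; [now left|]. intros z [<-|[]]. apply vle_refl.
  - destruct IH as [c [Hc1 Hc2]]; [discriminate|].
    destruct (vle_total n (l x) (l c)) as [H|H].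
    + exists c. split; [now right|]. intros z [<-|Hz]; auto.
    + exists x. split; [now left|]. intros z [<-|Hz]; [apply vle_refl|].
      pose proof (Hc2 z Hz). vlia.
Qed.

(** Here [q] is the merging point of [c']. A shorter [c] merges with the segment to [t] no later, up
    to bounded error, so at [q] it acts nearly as a translation by [tau c]. *)
Lemma displacement M q c c' : A c -> A c' -> K q -> l c <=v l c' ->
  tau_bounded M c -> tau_bounded M c' -> (0 <= M)%Z ->
  veq n (vscale 2 (l q)) (vsub (l c') (tau c')) -> veq n (l q +v D q t) (l t) ->
  D q (gmul c q) <=v kv (M + 6 * d).
Proof.
  intros Hc Hc' Hq Hle [B1 B2] [B3 B4] HM E1 E2.
  destruct (tau_shift c q Hc Hq) as [S1 S2].
  assert (Hci : K (ginv c)) by (apply (sub_inv G); auto; apply Hc).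
  destruct (tau_shift c (ginv c) Hc Hci) as [S3 S4].
  rewrite gmulVr, dist_one in S3, S4.
  assert (Ecq : D gone (gmul c q) = D (ginv c) q).
  { rewrite <- (dist_mul G l c (ginv c) q). now rewrite gmulVr. }
  rewrite dist_one in Ecq.
  pose proof (kv_add n M (6 * d)). pose proof (kv_scale n 6 d). pose proof (kv_scale n 2 d).
  pose proof (kv_opp n M).
  assert (P1 : vzero <=v kv M).
  { apply vle_of_coord; [exact HM|]. intros i Hi. now rewrite kv_coord by lia. }
  assert (P2 : vzero <=v kv d).
  { apply vle_of_coord; [apply Z.lt_le_incl; exact Hd|]. intros i Hi. now rewrite kv_coord by lia. }
  pose proof (l_nonneg q) as P3.
  pose proof (dist_to_one (ginv c)) as P4. pose proof (l_inv c) as P5.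
  pose proof (dist_sym q gone) as P6. rewrite dist_one in P6.
  pose proof (dist_sym q (gmul c q)) as P7.
  pose proof (dist_sym t gone) as P8. rewrite dist_one in P8.
  pose proof (dist_sym t q) as P9.
  pose proof (dist_sym t (gmul c q)) as P10.
  pose proof (dist_sym (gmul c q) gone) as P11. rewrite dist_one, Ecq in P11.
  (* The first alternative loses [2 d] here and [2 d] in [tau_shift]; the second uses [l c <= l c']
     and the formula for [l q]. One more four point condition brings the total to [6 d]. *)
  assert (Hfar : D (ginv c) q <=v l q +v kv M +v kv (4 * d)).
  { pose proof (kv_scale n 4 d).
    destruct (four_points gone (ginv c) q t) as [F|F]; rewrite !dist_one in F; clear P7 P8 P9 P10 P11; vlia. }
  pose proof (kv_scale n 4 d).
  pose proof (four_points gone q (gmul c q) t) as F.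
  rewrite !dist_one, Ecq in F.
  destruct F as [F|F]; clear P7 P8 P9 P10 P11; vlia.
Qed.

(** Conjugation by the merging point of a longest element injects any finite set of such elements
    into the ball [B], which is chosen before the set. *)
Lemma tau_bounded_finite M : (0 <= M)%Z ->
  exists F, forall a, A a -> tau_bounded M a -> In a F.
Proof.
  intros HM.
  destruct (Hprop (Z.to_nat (M + 6 * d))) as [B HB].
  destruct (finite_of_bounded G (fun a => A a /\ tau_bounded M a) (length B)) as [F HF].
  - intros F HF1 HF2. destruct F as [|x F]; [simpl; lia|].
    remember (x :: F) as F' eqn:EF.
    destruct (max_length F') as [c' [Hc1 Hc2]]; [now subst|].
    destruct (HF2 c' Hc1) as [Ac' Tc'].
    destruct (merging_point c' Ac') as [q [Hq [E1 E2]]].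
    rewrite <- (length_map (fun c => gmul (ginv q) (gmul c q)) F').
    apply NoDup_incl_length.
    + apply FinFun.Injective_map_NoDup; [|assumption]. intros a b E.
      replace a with (gmul q (gmul (gmul (ginv q) (gmul a q)) (ginv q))) by grp.
      rewrite E. grp.
    + intros y Hy. apply in_map_iff in Hy. destruct Hy as [c [<- Hc]].
      apply HB. destruct (HF2 c Hc) as [Ac Tc].
      exact (eq_ind _ (fun z => l _ <=v kv z) (displacement M q c c' Ac Ac' Hq (Hc2 c Hc) Tc Tc' HM E1 E2)
               _ (eq_sym (Z2Nat.id (M + 6 * d) ltac:(lia)))).
  - exists F. intros a Ha Hta. apply HF. now split.
Qed.

(** With [y = b^-1 a b], comparing [a b = b y] and [y = a (comm a b)] uses three defects of [2 d],
    within the bound [8 d]. *)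
Lemma tau_comm a b : A a -> A b -> tau_bounded (8 * d) (comm a b).
Proof.
  intros Ha Hb. unfold tau_bounded, comm.
  assert (Hab : A (gmul a b)) by (now apply sub_mul).
  assert (Hb' : A (gmul (ginv b) (gmul a b))) by (apply sub_mul; auto; now apply sub_inv).
  assert (Hab' : A (gmul (ginv a) (gmul (ginv b) (gmul a b))))
    by (apply (sub_mul G A SA); auto; now apply (sub_inv G A SA)).
  replace (gmul (gmul (ginv a) (ginv b)) (gmul a b))
    with (gmul (ginv a) (gmul (ginv b) (gmul a b))) by grp.
  destruct (tau_mul a b Ha Hb) as [U1 U2].
  destruct (tau_mul b (gmul (ginv b) (gmul a b)) Hb Hb') as [V1 V2].
  destruct (tau_mul a (gmul (ginv a) (gmul (ginv b) (gmul a b))) Ha Hab') as [W1 W2].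
  rewrite gmulVK in V1, V2, W1, W2.
  pose proof (kv_scale n 8 d). pose proof (kv_scale n 2 d). pose proof (kv_opp n (8 * d)).
  assert (P2 : vzero <=v kv d).
  { apply vle_of_coord; [apply Z.lt_le_incl; exact Hd|]. intros i Hi. now rewrite kv_coord by lia. }
  split; vlia.
Qed.

(* Commutators are finitely many and permuted by conjugation, so the elements of
   [A] commuting with all of them form a subgroup of finite index and class 2. *)
Lemma edge_virt_nilp : virt_nilp3 A.
Proof.
  set (C := fun c => exists x y, A x /\ A y /\ c = comm x y).
  assert (HC : exists F, forall c, In c F <-> C c).
  { destruct (tau_bounded_finite (8 * d)) as [F HF]; [lia|].
    destruct (list_restrict G C F) as [F' HF']. exists F'. intros c. rewrite HF'.
    split; [tauto|]. intros Hc. split; [|assumption]. destruct Hc as [x [y [Hx [Hy ->]]]].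
    apply HF; [|now apply tau_comm]. unfold comm.
    repeat apply (sub_mul G A SA); auto; now apply (sub_inv G A SA). }
  destruct HC as [F HF].
  exists (fun a => A a /\ forall c, C c -> gmul a c = gmul c a).
  split; [|split; [|split]].
  - split; [|split].
    + split; [now apply (sub_one G)|]. intros c _. grp.
    + intros x y [X1 X2] [Y1 Y2]. split; [now apply (sub_mul G)|].
      intros c Hc. rewrite gmulA_r, Y2, gmulA, X2 by assumption. grp.
    + intros x [X1 X2]. split; [now apply (sub_inv G)|].
      intros c Hc. apply (gmul_cancel_l G x). rewrite gmulVK, gmulA, X2 by assumption. grp.
  - tauto.
  - destruct (lists_over_finite G F (length F)) as [Fs HFs].
    (* An element is recorded by its conjugation action on the finite list of commutators; elements
       with equal records differ by one centralizing all commutators. *)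
    destruct (finite_representatives G (list G) A
      (fun a => map (fun c => gmul a (gmul c (ginv a))) F) Fs) as [rs [R1 R2]].
    { intros a Ha. apply HFs; [apply length_map|].
      intros x Hx. apply in_map_iff in Hx. destruct Hx as [c [<- Hc]].
      apply HF in Hc. destruct Hc as [x [y [Hx [Hy ->]]]]. apply HF.
      assert (Ha' := sub_inv G A SA a Ha).
      exists (gmul a (gmul x (ginv a))), (gmul a (gmul y (ginv a))).
      split; [|split]; [repeat apply (sub_mul G A SA); auto..|]. unfold comm. grp. }
    exists rs. split; [exact R1|]. intros a Ha. destruct (R2 a Ha) as [r [Hr E]].
    exists r, (gmul (ginv r) a). split; [assumption|]. split; [|now rewrite gmulVK].
    split; [apply (sub_mul G A SA); auto; apply (sub_inv G A SA); auto|].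
    intros c Hc. apply HF in Hc.
    assert (Ec : gmul r (gmul c (ginv r)) = gmul a (gmul c (ginv a))).
    { exact (ext_in_map E c Hc). }
    apply (f_equal (fun z => gmul (gmul (ginv r) z) a)) in Ec.
    revert Ec. autorewrite with grp. auto.
  - intros x1 x2 x3 x4 [H1 _] [H2 _] [H3 C3] _.
    assert (E : comm (comm x1 x2) x3 = gone).
    { assert (E : gmul x3 (comm x1 x2) = gmul (comm x1 x2) x3) by (apply C3; exists x1, x2; auto).
      generalize dependent (comm x1 x2). intros c E. unfold comm. rewrite <- E. grp. }
    rewrite E. unfold comm. grp.
Qed.

(** Euclidean descent: multiplying by a power of an [a0] with [chi a0 > E] brings [chi] into a
    bounded range. *)
Lemma quasimorphism_fin_gen (Q : G -> Prop) (chi : G -> Z) (E : Z) :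
  is_subgroup Q ->
  (forall a b, Q a -> Q b -> (Z.abs (chi (gmul a b) - chi a - chi b) <= E)%Z) ->
  (forall M, exists F, (forall a, In a F -> Q a) /\
     forall a, Q a -> (Z.abs (chi a) <= M)%Z -> gen F a) ->
  fin_gen_sub Q.
Proof.
  intros SQ Hchi HF.
  assert (Hone : (Z.abs (chi gone) <= E)%Z).
  { pose proof (Hchi gone gone) as H. rewrite gmul1l in H.
    specialize (H (sub_one G Q SQ) (sub_one G Q SQ)). lia. }
  destruct (classic (exists a, Q a /\ (E < chi a)%Z)) as [[a0 [Ha0 E0]]|Hno].
  - destruct (HF (chi a0 + E)%Z) as [F [F1 F2]].
    apply (fin_gen_sub_intro G (a0 :: F)).
    { intros x [<-|Hx]; auto. }
    assert (Sg := gen_subgroup G (a0 :: F)).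
    assert (G0 : gen (a0 :: F) a0) by (apply gen_in; now left).
    intros g. remember (Z.to_nat (Z.abs (chi g))) as m eqn:Em. revert g Em.
    induction m as [m IH] using (well_founded_induction lt_wf). intros g Em Hg.
    destruct (Z.le_gt_cases (Z.abs (chi g)) (chi a0 + E)) as [Hs|Hs].
    { apply (gen_incl G F); [intros x Hx; now right|]. auto. }
    destruct (Z.le_gt_cases 0 (chi g)) as [Hp|Hp].
    + assert (Q (gmul (ginv a0) g)) by (apply sub_mul; auto; now apply sub_inv).
      pose proof (Hchi a0 (gmul (ginv a0) g) Ha0 ltac:(assumption)) as H'.
      rewrite gmulVK in H'.
      rewrite <- (gmulVK G a0 g). apply (sub_mul G _ Sg); [assumption|].
      apply (IH (Z.to_nat (Z.abs (chi (gmul (ginv a0) g))))); auto. lia.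
    + assert (Q (gmul a0 g)) by (apply sub_mul; auto).
      pose proof (Hchi a0 g Ha0 Hg) as H'.
      rewrite <- (gmulKV G a0 g). apply (sub_mul G _ Sg); [now apply (sub_inv G _ Sg)|].
      apply (IH (Z.to_nat (Z.abs (chi (gmul a0 g))))); auto. lia.
  - destruct (HF (3 * E)%Z) as [F [F1 F2]].
    apply (fin_gen_sub_intro G F); [assumption|].
    intros g Hg. apply F2; [assumption|].
    assert (B : forall a, Q a -> (chi a <= E)%Z).
    { intros a Ha. apply Z.le_ngt. intros Hlt. apply Hno. now exists a. }
    pose proof (B g Hg). pose proof (B (ginv g) (sub_inv G Q SQ g Hg)).
    pose proof (Hchi g (ginv g) Hg (sub_inv G Q SQ g Hg)) as H'. rewrite gmulVr in H'. lia.
Qed.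

Let Aj (j : nat) (a : G) : Prop := A a /\ forall i, j < i <= n -> tau a i = 0%Z.

(** The defect lies in coordinate 1, so all higher coordinates of [tau] are homomorphisms to [Z] on
    [A]. *)
Lemma tau_mul_coord a b : A a -> A b ->
  (Z.abs (tau (gmul a b) 1%nat - tau a 1%nat - tau b 1%nat) <= 2 * d)%Z /\
  forall i, 1 < i <= n -> tau (gmul a b) i = (tau a i + tau b i)%Z.
Proof.
  intros Ha Hb. destruct (tau_mul a b Ha Hb) as [H1 H2].
  pose proof (kv_opp n (2 * d)).
  destruct (kv_bounded n (vsub (tau (gmul a b)) (tau a +v tau b)) (2 * d) Hn) as [H3 H4].
  - vlia.
  - vlia.
  - split; [unfold vsub, vadd in H3; lia|]. intros i Hi. specialize (H4 i Hi).
    unfold vsub, vadd in H4. lia.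
Qed.

Lemma Aj_subgroup j : 1 <= j -> is_subgroup (Aj j).
Proof.
  intros Hj.
  assert (E1 : forall i, 1 < i <= n -> tau gone i = 0%Z).
  { intros i Hi. unfold tau, vsub. rewrite dist_one. lia. }
  split; [|split].
  - split; [now apply (sub_one G)|]. intros i Hi. apply E1. lia.
  - intros x y [X1 X2] [Y1 Y2]. split; [now apply (sub_mul G)|].
    intros i Hi. rewrite (proj2 (tau_mul_coord x y X1 Y1)) by lia. rewrite X2, Y2 by lia. reflexivity.
  - intros x [X1 X2]. assert (X3 : A (ginv x)) by (now apply (sub_inv G)). split; [assumption|].
    intros i Hi. pose proof (proj2 (tau_mul_coord x (ginv x) X1 X3) i ltac:(lia)) as E.
    rewrite gmulVr, E1, X2 in E by lia. lia.
Qed.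

(** At the bottom, [tau] is a quasimorphism to [Z] with finite bounded sets. Further up, coordinate
    [S j] is a homomorphism with kernel [Aj j], whose level sets are cosets of that kernel. *)
Lemma Aj_fin_gen j : 1 <= j <= k -> fin_gen_sub (Aj j).
Proof.
  induction j as [|j IH]; intros Hj; [lia|].
  destruct (Nat.eq_dec j 0) as [->|Hj0].
  - apply (quasimorphism_fin_gen (Aj 1) (fun a => tau a 1%nat) (2 * d)).
    + apply Aj_subgroup. lia.
    + intros a b Ha Hb. apply tau_mul_coord; [apply Ha|apply Hb].
    + intros M. destruct (tau_bounded_finite (Z.abs M)) as [F HF]; [lia|].
      destruct (list_restrict G (Aj 1) F) as [F' HF']. exists F'. split; [intros a; apply HF'|].
      intros a Ha HM. apply gen_in, HF'. split; [|assumption].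
      apply HF; [apply Ha|]. split.
      * apply vle_of_coord; [unfold kv; simpl; lia|]. intros i Hi.
        rewrite kv_coord by lia. apply Ha. lia.
      * apply vle_of_coord; [unfold kv; simpl; lia|]. intros i Hi.
        rewrite kv_coord by lia. symmetry. apply Ha. lia.
  - destruct IH as [X [X1 X2]]; [lia|].
    assert (SQ : is_subgroup (Aj (S j))) by (apply Aj_subgroup; lia).
    assert (Hadd : forall a b, Aj (S j) a -> Aj (S j) b ->
      tau (gmul a b) (S j) = (tau a (S j) + tau b (S j))%Z).
    { intros a b Ha Hb. apply tau_mul_coord; [apply Ha|apply Hb|lia]. }
    apply (quasimorphism_fin_gen (Aj (S j)) (fun a => tau a (S j)) 0); [exact SQ| |].
    + intros a b Ha Hb. rewrite Hadd by assumption. lia.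
    + assert (Hval : forall v, exists F, (forall a, In a F -> Aj (S j) a) /\
        forall a, Aj (S j) a -> tau a (S j) = v -> gen F a).
      { intros v. destruct (classic (exists r, Aj (S j) r /\ tau r (S j) = v)) as [[r [Hr Er]]|Hno].
        - exists (r :: X). split.
          + intros a [<-|Ha]; [assumption|]. destruct (X1 a Ha) as [A1 A2]. split; [assumption|].
            intros i Hi. apply A2. lia.
          + intros a Ha Ea. rewrite <- (gmulVK G r a).
            apply (sub_mul G _ (gen_subgroup G _)); [apply gen_in; now left|].
            apply (gen_incl G X); [intros x Hx; now right|]. apply X2.
            assert (Hra : Aj (S j) (gmul (ginv r) a)).
            { apply (sub_mul G); auto. now apply (sub_inv G). }
            split; [apply Hra|]. intros i Hi. destruct (Nat.eq_dec i (S j)) as [->|Hne].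
            * pose proof (Hadd r (gmul (ginv r) a) Hr Hra) as E. rewrite gmulVK in E. lia.
            * apply Hra. lia.
        - exists []. split; [intros a []|]. intros a Ha Ea. exfalso. apply Hno. now exists a. }
      assert (Hnat : forall m : nat, exists F, (forall a, In a F -> Aj (S j) a) /\
        forall a, Aj (S j) a -> (Z.abs (tau a (S j)) <= Z.of_nat m)%Z -> gen F a).
      { induction m as [|m [F [F1 F2]]].
        - destruct (Hval 0%Z) as [F [F1 F2]]. exists F. split; [assumption|].
          intros a Ha HM. apply F2; [assumption|lia].
        - destruct (Hval (Z.of_nat (S m))) as [F' [F1' F2']].
          destruct (Hval (- Z.of_nat (S m))%Z) as [F'' [F1'' F2'']].
          exists (F ++ F' ++ F''). split.
          + intros a Ha. rewrite !in_app_iff in Ha. destruct Ha as [?|[?|?]]; auto.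
          + intros a Ha HM.
            destruct (Z.eq_dec (tau a (S j)) (Z.of_nat (S m))) as [e|e];
              [apply (gen_incl G F'); [intros x; rewrite !in_app_iff; tauto|now apply F2']|].
            destruct (Z.eq_dec (tau a (S j)) (- Z.of_nat (S m))) as [e'|e'];
              [apply (gen_incl G F''); [intros x; rewrite !in_app_iff; tauto|now apply F2'']|].
            apply (gen_incl G F); [intros x; rewrite !in_app_iff; tauto|]. apply F2; [assumption|lia]. }
      intros M. destruct (Hnat (Z.to_nat M)) as [F [F1 F2]]. exists F. split; [assumption|].
      intros a Ha HM. apply F2; [assumption|lia].
Qed.

(** The shift vanishes above coordinate [k] because crossing distances agree there, so [A] is the
    last step [Aj k] of the filtration. *)
Lemma edge_fin_gen : fin_gen_sub A.
Proof.
  destruct (Aj_fin_gen k) as [X [X1 X2]]; [lia|].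
  apply (fin_gen_sub_intro G X); [intros x Hx; apply (X1 x Hx)|].
  intros a Ha. apply X2. split; [assumption|]. intros i Hi. unfold tau, vsub.
  destruct (top_cross a t (proj1 Ha) t_in) as [C1 C2].
  destruct (Nat.eq_dec i (S k)) as [->|Hne]; [unfold dist; lia|].
  rewrite Gk_iff in C1. unfold dist. rewrite C1 by lia.
  rewrite (proj1 (Gk_iff _ _) Ht) by lia. reflexivity.
Qed.

(* If [t] flips the edge then [a = t^2] commutes with [t]; exchanging the two
   sides turns the shift of each [a^m] into its opposite, so it stays bounded. *)
Lemma edge_flip_torsion : K (gmul t t) -> exists m, 0 < m /\ gpow (gmul t t) m = gone.
Proof.
  intros Htt. set (a := gmul t t) in *.
  assert (Hcomm : forall m, gmul t (gpow a m) = gmul (gpow a m) t).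
  { induction m as [|m IH]; simpl; [grp|].
    rewrite !gmulA_r, <- IH. unfold a. grp. }
  assert (HA : forall m, A (gpow a m)).
  { intros m. apply sub_gpow; [exact SA|]. split; [assumption|].
    replace (gmul (ginv t) (gmul a t)) with a by (unfold a; grp). assumption. }
  assert (HB : forall m, tau_bounded d (gpow a m)).
  { intros m. set (b := gpow a m) in *.
    assert (Hb : A b) by apply HA.
    assert (H1 : K gone) by (now apply (sub_one G)).
    assert (Hy : K (gmul (ginv t) (gmul (ginv t) b))).
    { replace (gmul (ginv t) (gmul (ginv t) b)) with (gmul (ginv a) b) by (unfold a; grp).
      apply (sub_mul G); auto; [now apply (sub_inv G)|apply Hb]. }
    (* Both [t] and [t^-1 b] lie across the edge. Since [b] commutes with [t], the inequalities say
       that [2 D b t] and [2 l t] differ by at most [2 d]. *)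
    pose proof (cross b gone t (gmul (ginv t) b) (proj1 Hb) H1 t_in Hy) as C1.
    pose proof (cross b gone (gmul (ginv t) b) t (proj1 Hb) H1 Hy t_in) as C2.
    rewrite !dist_one in C1, C2.
    assert (E1 : veq n (D b (gmul (ginv t) b)) (l t)).
    { unfold dist. replace (gmul (ginv b) (gmul (ginv t) b)) with (ginv (gmul (ginv b) (gmul t b))) by grp.
      unfold b at 2 in |- *. rewrite Hcomm. fold b. rewrite gmulKV. apply l_inv. }
    assert (E2 : veq n (l (gmul (ginv t) b)) (D b t)).
    { unfold dist. replace (gmul (ginv t) b) with (ginv (gmul (ginv b) t)) by grp. apply l_inv. }
    pose proof (kv_scale n 2 d). pose proof (kv_opp n d).
    unfold tau_bounded, tau. split; vlia. }
  destruct (tau_bounded_finite d) as [F HF]; [lia|].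
  destruct (classic (exists i j, i < j /\ gpow a i = gpow a j)) as [[i [j [Hij E]]]|Hno].
  - exists (j - i). split; [lia|]. replace j with (i + (j - i)) in E by lia.
    rewrite gpow_add in E. apply (gmul_cancel_l G (gpow a i)). rewrite <- E. grp.
  - exfalso.
    assert (HN : NoDup (map (gpow a) (seq 0 (S (length F))))).
    { apply FinFun.Injective_map_NoDup; [|apply seq_NoDup].
      intros i j E. destruct (Nat.lt_trichotomy i j) as [Hl'|[?|Hl']]; auto; exfalso; apply Hno.
      - now exists i, j.
      - now exists j, i. }
    apply (NoDup_incl_length (l' := F)) in HN.
    + rewrite length_map, length_seq in HN. lia.
    + intros x Hx. apply in_map_iff in Hx. destruct Hx as [m [<- _]]. now apply HF.
Qed.
End Edge.

Lemma no_edge_flip k s : torsion_free G -> 1 <= k < n ->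
  Gk n l (S k) s -> Gk n l k (gmul s s) -> Gk n l k s.
Proof.
  intros Htf Hk Hs Hss. apply NNPP. intros Hn'.
  destruct (edge_flip_torsion k s Hk Hs Hn' Hss) as [m [Hm E]].
  apply Hn'. apply Htf in E; [|assumption].
  assert (E' : s = gone) by (apply (Htf s 2); [lia|simpl; now rewrite gmul1r]).
  rewrite E'. apply (sub_one G _ (Gk_subgroup k)).
Qed.
End Metric.

(** * Word hyperbolicity *)

Lemma exponential_beats_linear (X Y : nat) :
  exists K0, forall k, K0 <= k -> X + Y * k < 2 ^ k.
Proof.
  (* [2^(2 m)] is at least [(m + 1)^2], which beats [X + 2 Y m]; beyond that each doubling gains at
     least [Y]. *)
  set (m := X + 2 * Y). exists (2 * m).
  assert (H0 : X + Y * (2 * m) < 2 ^ (2 * m) /\ Y <= 2 ^ (2 * m)).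
  { pose proof (Nat.pow_gt_lin_r 2 m ltac:(lia)) as H.
    replace (2 * m) with (m + m) by lia. rewrite Nat.pow_add_r.
    assert ((m + 1) * (m + 1) <= 2 ^ m * 2 ^ m) by (apply Nat.mul_le_mono; lia).
    assert (H1 : X <= m) by (unfold m; lia). assert (H2 : 2 * Y <= m) by (unfold m; lia).
    clearbody m. assert (H3 : (2 * Y) * m <= m * m) by (apply Nat.mul_le_mono; lia).
    split; nia. }
  intros k Hk. assert (H : X + Y * k < 2 ^ k /\ Y <= 2 ^ k); [|tauto].
  induction Hk as [|k Hk IH]; [assumption|].
  rewrite Nat.pow_succ_r'. destruct IH. split; nia.
Qed.

(** Taking for [k] the rounded-up binary logarithm of [6 x + c], the bound [2 x <= a + b k] confines
    [k] and hence [x]. The form [6 x + c] is the detour length in [farthest_bound]. *)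
Lemma logarithmic_bound (a b c : Z) : (0 <= a)%Z -> (0 <= b)%Z -> (0 <= c)%Z ->
  exists C, (0 <= C)%Z /\ forall x, (0 <= x)%Z ->
    (forall k : nat, (6 * x + c <= Z.of_nat (2 ^ k))%Z -> (2 * x <= a + b * Z.of_nat k)%Z) ->
    (x <= C)%Z.
Proof.
  intros Ha Hb Hc.
  destruct (exponential_beats_linear (Z.to_nat (3 * a + c + 3 * b)) (Z.to_nat (3 * b))) as [K0 HK].
  exists (a + b * Z.of_nat (S K0))%Z.
  assert (HbK : (0 <= b * Z.of_nat (S K0))%Z) by (apply Z.mul_nonneg_nonneg; lia).
  split; [lia|]. intros x Hx H.
  destruct (Z.le_gt_cases (6 * x + c) 1) as [Hs|Hs].
  { specialize (H 0 ltac:(change (2 ^ 0) with 1; lia)). rewrite Z.mul_0_r in H. lia. }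
  destruct (Nat.log2_up_spec (Z.to_nat (6 * x + c)) ltac:(lia)) as [L1 L2].
  set (k := Nat.log2_up (Z.to_nat (6 * x + c))) in *.
  specialize (H k ltac:(lia)).
  assert (Hk : k <= S K0).
  { apply Nat.nlt_ge. intros Hlt. specialize (HK (pred k) ltac:(lia)).
    assert (HK' : (3 * a + c + 3 * b + 3 * (b * Z.of_nat (pred k)) < Z.of_nat (2 ^ pred k))%Z).
    { apply inj_lt in HK. rewrite Nat2Z.inj_add, Nat2Z.inj_mul, !Z2Nat.id in HK by lia. lia. }
    assert (Ek : Z.of_nat k = (Z.of_nat (pred k) + 1)%Z) by lia.
    rewrite Ek, Z.mul_add_distr_l in H. lia. }
  assert (b * Z.of_nat k <= b * Z.of_nat (S K0))%Z by (apply Z.mul_le_mono_nonneg_l; lia).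
  lia.
Qed.

Lemma bounded_maximum (Q : Z -> Prop) (B x : Z) :
  (forall y, Q y -> (y <= B)%Z) -> Q x -> exists y, (x <= y)%Z /\ Q y /\ ~ Q (y + 1)%Z.
Proof.
  intros HB. remember (Z.to_nat (B - x)) as m eqn:Em. revert x Em.
  induction m as [|m IH]; intros x Em Hx.
  - exists x. split; [lia|]. split; [assumption|]. intros H. pose proof (HB _ H).
    pose proof (HB _ Hx). lia.
  - destruct (classic (Q (x + 1)%Z)) as [H|H].
    + destruct (IH (x + 1)%Z ltac:(lia) H) as [y [H1 H2]]. exists y. split; [lia|assumption].
    + exists x. split; [lia|]. now split.
Qed.

(** In contrast to [tree_length], [hl_reg] keeps two branch points, because on [G_1] the error
    [4 delta] is visible. *)
Record hyperbolic_length {G : Group} (P : G -> Prop) (ell : G -> Z) (d : Z) : Prop := {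
  hl_sub : is_subgroup P;
  hl_d : (0 <= d)%Z;
  hl_one : ell gone = 0%Z;
  hl_nonneg : forall g, P g -> (0 <= ell g)%Z;
  hl_inv : forall g, P g -> ell (ginv g) = ell g;
  hl_tri : forall g h, P g -> P h -> (ell (gmul g h) <= ell g + ell h)%Z;
  hl_hyp : forall f g h, P f -> P g -> P h ->
    (ell (gmul (ginv f) g) + ell h <= ell (gmul (ginv f) h) + ell g + 2 * d)%Z \/
    (ell (gmul (ginv f) g) + ell h <= ell (gmul (ginv g) h) + ell f + 2 * d)%Z;
  hl_reg : forall g h, P g -> P h -> exists u v, P u /\ P v /\
    (2 * ell u = ell g + ell h - ell (gmul (ginv g) h))%Z /\ ell v = ell u /\
    (ell u + ell (gmul (ginv u) g) = ell g)%Z /\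
    (ell v + ell (gmul (ginv v) h) = ell h)%Z /\
    (ell (gmul (ginv u) v) <= 4 * d)%Z;
  hl_proper : forall m : Z, exists F, forall g, P g -> (ell g <= m)%Z -> In g F;
  hl_fin_gen : fin_gen_sub P }.

Section WordHyperbolic.
Variables (G : Group) (P : G -> Prop) (ell : G -> Z) (d : Z).
Hypothesis HL : hyperbolic_length P ell d.

Let SP := hl_sub _ _ _ HL.
Let Hd := hl_d _ _ _ HL.
Let e (x y : G) : Z := ell (gmul (ginv x) y).

Lemma P_diff x y : P x -> P y -> P (gmul (ginv x) y).
Proof. intros Hx Hy. apply sub_mul; auto. now apply sub_inv. Qed.

Lemma e_nonneg x y : P x -> P y -> (0 <= e x y)%Z.
Proof. intros Hx Hy. apply (hl_nonneg _ _ _ HL). now apply P_diff. Qed.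

Lemma e_refl x : e x x = 0%Z.
Proof. unfold e. rewrite gmulVl. apply (hl_one _ _ _ HL). Qed.

Lemma e_one x : e gone x = ell x.
Proof. unfold e. f_equal. grp. Qed.

Lemma e_sym x y : P x -> P y -> e x y = e y x.
Proof.
  intros Hx Hy. unfold e. rewrite <- (hl_inv _ _ _ HL) by (now apply P_diff). f_equal. grp.
Qed.

Lemma e_to_one x : P x -> e x gone = ell x.
Proof. intros Hx. rewrite e_sym, e_one; auto. now apply sub_one. Qed.

Lemma e_mul g x y : e (gmul g x) (gmul g y) = e x y.
Proof. unfold e. f_equal. grp. Qed.

Lemma e_tri x y z : P x -> P y -> P z -> (e x z <= e x y + e y z)%Z.
Proof.
  intros Hx Hy Hz. unfold e.
  replace (gmul (ginv x) z) with (gmul (gmul (ginv x) y) (gmul (ginv y) z)) by grp.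
  apply (hl_tri _ _ _ HL); now apply P_diff.
Qed.

Lemma e_four w x y z : P w -> P x -> P y -> P z ->
  (e x y + e w z <= e x z + e w y + 2 * d)%Z \/ (e x y + e w z <= e y z + e w x + 2 * d)%Z.
Proof.
  intros Hw Hx Hy Hz.
  pose proof (hl_hyp _ _ _ HL (gmul (ginv w) x) (gmul (ginv w) y) (gmul (ginv w) z)
    (P_diff w x Hw Hx) (P_diff w y Hw Hy) (P_diff w z Hw Hz)) as H.
  fold (e w x) (e w y) (e w z) in H.
  change (ell (gmul (ginv (gmul (ginv w) x)) (gmul (ginv w) z))) with (e (gmul (ginv w) x) (gmul (ginv w) z)) in H.
  change (ell (gmul (ginv (gmul (ginv w) y)) (gmul (ginv w) z))) with (e (gmul (ginv w) y) (gmul (ginv w) z)) in H.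
  change (ell (gmul (ginv (gmul (ginv w) x)) (gmul (ginv w) y))) with (e (gmul (ginv w) x) (gmul (ginv w) y)) in H.
  rewrite !e_mul in H. exact H.
Qed.

(** Twice the Gromov product of [x] and [y] based at [o]. *)
Let C2 (o x y : G) : Z := (e o x + e o y - e x y)%Z.

Lemma C2_hyp o x y z : P o -> P x -> P y -> P z ->
  (C2 o x y - 2 * d <= C2 o x z)%Z \/ (C2 o y z - 2 * d <= C2 o x z)%Z.
Proof.
  intros Ho Hx Hy Hz. unfold C2.
  destruct (e_four o x z y Ho Hx Hz Hy) as [H|H]; [left|right].
  - lia.
  - rewrite (e_sym y z) by assumption. lia.
Qed.

(* Along a generating word for [g] the Gromov product with [g] moves from [0] to
   [l g] in bounded steps, and regularity turns its values into points of [G]. *)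
Lemma coarse_geodesic : exists M, (1 <= M)%Z /\ forall g v, P g -> (0 <= v <= ell g)%Z ->
  exists u, P u /\ (ell u + e u g = ell g)%Z /\ (v <= ell u <= v + M)%Z.
Proof.
  destruct (hl_fin_gen _ _ _ HL) as [X [X1 X2]].
  assert (HM : exists M, (1 <= M)%Z /\ forall x, In x X -> (ell x <= M)%Z).
  { clear. induction X as [|x X [M [M1 M2]]].
    - exists 1%Z. split; [lia|]. intros x [].
    - exists (Z.max M (ell x)). split; [lia|]. intros y [<-|Hy]; [lia|].
      specialize (M2 y Hy). lia. }
  destruct HM as [M [M1 M2]]. exists M. split; [assumption|]. intros g v Hg Hv.
  (* [p] runs through prefixes of a word for [g]. A letter changes the doubled product by at most
     [2 M], so the first prefix reaching [2 v] overshoots by no more than that. *)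
  assert (Hw : forall w p, P p -> word_over X w -> gmul p (word_eval w) = g ->
    (C2 gone g p <= 2 * v + 2 * M)%Z -> exists q, P q /\ (2 * v <= C2 gone g q <= 2 * v + 2 * M)%Z).
  { induction w as [|x w IH]; intros p Hp Hw Ew Hc; simpl in Ew.
    - rewrite gmul1r in Ew. subst p. exists g. split; [assumption|].
      unfold C2 in *. rewrite e_refl, !e_one in *. lia.
    - destruct (Z.le_gt_cases (2 * v) (C2 gone g p)) as [Hle|Hgt]; [exists p; auto|].
      assert (Hx : P x /\ (ell x <= M)%Z).
      { destruct (Hw x (or_introl eq_refl)) as [Hx|Hx]; [split; auto|].
        pose proof (X1 _ Hx) as Px. assert (Px' : P x) by (rewrite <- (ginv_inv G x); now apply sub_inv).
        split; [assumption|]. rewrite <- (hl_inv _ _ _ HL) by assumption. auto. }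
      destruct Hx as [Px Lx].
      assert (Ppx : P (gmul p x)) by (now apply sub_mul).
      apply (IH (gmul p x)); auto.
      + intros y Hy. apply Hw. now right.
      + now rewrite gmulA_r.
      + assert (E : e p (gmul p x) = ell x) by (unfold e; now rewrite gmulKV).
        pose proof (e_tri gone p (gmul p x) (sub_one G P SP) Hp Ppx).
        pose proof (e_tri g (gmul p x) p Hg Ppx Hp).
        rewrite (e_sym (gmul p x) p) in * by assumption. unfold C2 in *. lia. }
  destruct (X2 g Hg) as [w [W1 W2]].
  destruct (Hw w gone (sub_one G P SP) W1) as [q [Q1 Q2]].
  - now rewrite gmul1l.
  - unfold C2. rewrite (e_sym g gone), !e_one, (hl_one _ _ _ HL); auto; [lia|now apply sub_one].
  - destruct (hl_reg _ _ _ HL g q Hg Q1) as [u [_ [U1 [_ [U2 [_ [U3 _]]]]]]].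
    exists u. split; [assumption|]. split; [exact U3|].
    unfold C2 in Q2. rewrite !e_one in Q2. unfold e in Q2. lia.
Qed.

(** * Shortest words and the Morse lemma *)

Section Words.
Variables (M : Z) (S : list G).
Hypothesis HM1 : (1 <= M)%Z.
Hypothesis HM : forall g v, P g -> (0 <= v <= ell g)%Z ->
  exists u, P u /\ (ell u + e u g = ell g)%Z /\ (v <= ell u <= v + M)%Z.
(** Large enough that a point found at level [v = 1] is itself a letter. *)
Let R : Z := (M + 1)%Z.
Hypothesis HS : forall g, In g S <-> P g /\ (ell g <= R)%Z.

Lemma letter_short w x : word_over S w -> In x w -> P x /\ (ell x <= R)%Z.
Proof.
  intros Hw Hx. destruct (Hw x Hx) as [H|H]; [now apply HS|].
  apply HS in H. destruct H as [H1 H2].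
  assert (Hx' : P x) by (rewrite <- (ginv_inv G x); now apply sub_inv).
  split; [assumption|]. now rewrite <- (hl_inv _ _ _ HL).
Qed.

Lemma word_over_in w : word_over S w -> P (word_eval w).
Proof. apply (sub_word_eval G P SP S). intros x Hx. now apply HS. Qed.

(** Each letter split off uses up at least [1] of the length, as the remainder is exactly additive;
    the [+ 1] pays for the last letter. *)
Lemma short_word g : P g ->
  exists w, word_over S w /\ word_eval w = g /\ (Z.of_nat (length w) <= ell g + 1)%Z.
Proof.
  intros Hg. remember (Z.to_nat (ell g)) as m eqn:Em. revert g Em Hg.
  induction m as [m IH] using (well_founded_induction lt_wf). intros g Em Hg.
  pose proof (hl_nonneg _ _ _ HL g Hg) as H0.
  destruct (Z.le_gt_cases (ell g) R) as [Hs|Hs].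
  - exists [g]. split; [|split; [simpl; grp|simpl; lia]].
    intros x [<-|[]]. left. now apply HS.
  - destruct (HM g 1%Z Hg) as [u [U1 [U2 U3]]]; [unfold R in Hs; lia|].
    pose proof (P_diff u g U1 Hg) as Hug. pose proof (hl_nonneg _ _ _ HL _ Hug).
    unfold e in U2.
    destruct (IH (Z.to_nat (ell (gmul (ginv u) g))) ltac:(lia) _ eq_refl Hug) as [w [W1 [W2 W3]]].
    exists (u :: w). split; [|split].
    + intros x [<-|Hx]; [left; apply HS; split; [assumption|unfold R; lia]|auto].
    + simpl. rewrite W2. grp.
    + simpl length. lia.
Qed.

Lemma wlen_exists g : P g -> exists N, is_wlen S g N.
Proof.
  intros Hg. destruct (short_word g Hg) as [w [W1 [W2 _]]].
  remember (length w) as N eqn:EN. revert w W1 W2 EN.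
  induction N as [N IH] using (well_founded_induction lt_wf). intros w W1 W2 EN.
  destruct (classic (exists w', word_over S w' /\ word_eval w' = g /\ length w' < N))
    as [[w' [A1 [A2 A3]]]|Hno].
  - now apply (IH (length w') A3 w').
  - exists N. split; [exists w; auto|]. intros w' A1 A2. apply Nat.nlt_ge. intros A3.
    apply Hno. now exists w'.
Qed.

(* Gromov products lose only logarithmically many [d]'s along a chain. *)
Lemma chain (p : nat -> G) (o : G) (Theta : Z) : P o -> (forall i, P (p i)) ->
  (forall i, (Theta <= C2 o (p i) (p i))%Z) ->
  (forall i, (Theta <= C2 o (p i) (p (Datatypes.S i)))%Z) ->
  forall k i j, i <= j -> j - i <= 2 ^ k -> (Theta - 2 * d * Z.of_nat k <= C2 o (p i) (p j))%Z.
Proof.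
  intros Ho Hp H0 H1. induction k as [|k IH]; intros i j Hij Hk.
  - simpl in Hk. destruct (Nat.eq_dec i j) as [->|Hne].
    + specialize (H0 j). lia.
    + replace j with (Datatypes.S i) by lia. specialize (H1 i). lia.
  - rewrite Nat.pow_succ_r' in Hk. set (m := Nat.min j (i + 2 ^ k)).
    pose proof (IH i m ltac:(lia) ltac:(lia)). pose proof (IH m j ltac:(lia) ltac:(lia)).
    destruct (C2_hyp o (p i) (p m) (p j)); auto; lia.
Qed.

Section Morse.
Variables (g : G) (w : list G).
Hypothesis Hw : word_over S w.
Hypothesis Ew : word_eval w = g.
Hypothesis Hmin : forall w', word_over S w' -> word_eval w' = g -> length w <= length w'.

Let Hg : P g.
Proof. rewrite <- Ew. now apply word_over_in. Qed.

(** The path stays at [g] after its end, so that claims about it need no bound on the index. *)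
Let p (i : nat) : G := word_eval (firstn i w).

Lemma word_over_firstn i : word_over S (firstn i w).
Proof.
  intros x Hx. apply Hw. rewrite <- (firstn_skipn i w). apply in_or_app. now left.
Qed.

Lemma word_over_skipn i : word_over S (skipn i w).
Proof.
  intros x Hx. apply Hw. rewrite <- (firstn_skipn i w). apply in_or_app. now right.
Qed.

Lemma path_in i : P (p i).
Proof. apply word_over_in, word_over_firstn. Qed.

Lemma path_split i : gmul (p i) (word_eval (skipn i w)) = g.
Proof. unfold p. now rewrite <- word_eval_app, firstn_skipn. Qed.

Lemma path_step i : (e (p i) (p (Datatypes.S i)) <= R)%Z.
Proof.
  destruct (Nat.le_gt_cases (length w) i) as [Hi|Hi].
  - unfold p. rewrite !firstn_all2 by lia. rewrite e_refl. unfold R. lia.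
  - assert (E : p (Datatypes.S i) = gmul (p i) (nth i w gone)).
    { clear Hw Ew Hmin Hg. unfold p. revert i Hi. induction w as [|x v IH]; intros i Hi; simpl in Hi; [lia|].
      destruct i as [|i]; simpl; [grp|]. rewrite <- gmulA, <- IH by lia. reflexivity. }
    rewrite E. unfold e. rewrite gmulKV. apply (letter_short w); [exact Hw|]. now apply nth_In.
Qed.

(** Replacing the segment between [i] and [j] by a word from [short_word] cannot shorten a shortest
    word. *)
Lemma path_quasi i j : i <= j -> j <= length w -> (Z.of_nat (j - i) <= e (p i) (p j) + 1)%Z.
Proof.
  intros Hij Hj.
  destruct (short_word (gmul (ginv (p i)) (p j))) as [v [V1 [V2 V3]]].
  { apply P_diff; apply path_in. }
  specialize (Hmin (firstn i w ++ v ++ skipn j w)).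
  rewrite !length_app, length_firstn, length_skipn in Hmin.
  assert (H : length w <= Nat.min i (length w) + (length v + (length w - j))).
  { apply Hmin.
    - repeat apply word_over_app; auto; [apply word_over_firstn|apply word_over_skipn].
    - rewrite !word_eval_app, V2. fold (p i). rewrite gmulA_r, path_split. grp. }
  unfold e. lia.
Qed.

(** Outside the ball of radius [D] about [o], consecutive path points have doubled product at least
    [2 D - R]; [path_quasi] bounds the number of steps for [chain]. *)
Lemma path_nearby_C2 o D i j k : P o -> (forall a, (D <= e o (p a))%Z) ->
  i <= length w -> j <= length w -> (e (p i) (p j) + 1 <= Z.of_nat (2 ^ k))%Z ->
  (0 <= D)%Z -> (2 * D - R - 2 * d * Z.of_nat k <= C2 o (p i) (p j))%Z.
Proof.
  intros Ho HD Hi Hj Hk HD0.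
  assert (H0 : forall a, (2 * D - R <= C2 o (p a) (p a))%Z).
  { intros a. unfold C2. rewrite e_refl. specialize (HD a). unfold R. lia. }
  assert (H1 : forall a, (2 * D - R <= C2 o (p a) (p (Datatypes.S a)))%Z).
  { intros a. unfold C2. pose proof (HD a). pose proof (HD (Datatypes.S a)).
    pose proof (path_step a). lia. }
  destruct (Nat.le_gt_cases i j) as [Hij|Hij].
  - apply chain; auto; [apply path_in|]. pose proof (path_quasi i j Hij Hj). lia.
  - assert (Es : C2 o (p i) (p j) = C2 o (p j) (p i)).
    { unfold C2. rewrite (e_sym (p i)) by apply path_in. lia. }
    rewrite Es. apply chain; auto; [apply path_in|lia|].
    pose proof (path_quasi j i ltac:(lia) Hi) as H. rewrite (e_sym (p j)) in H by apply path_in. lia.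
Qed.

Section Farthest.
(** [U] is the set of approximate geodesic points, and [o] is one of them at the maximal distance
    [D] from the path. *)
Variables (E D : Z) (o : G).
Let U (u : G) : Prop := P u /\ (ell u + e u g <= ell g + E)%Z.
Hypothesis HE : (0 <= E)%Z.
Hypothesis HD : (0 <= D)%Z.
Hypothesis Uo : U o.
Hypothesis far : forall a, (D <= e o (p a))%Z.
Hypothesis near : forall u, U u -> exists i, i <= length w /\ (e u (p i) <= D)%Z.

(** Going [2 D] from [o] towards an end of the path gives a point whose nearest path point is still
    on the same side as seen from [o]. If the end is closer than [2 D], the end itself serves. *)
Lemma side_point i0 : i0 <= length w ->
  (forall y, P y -> (e o y + e y (p i0) = e o (p i0))%Z -> U y) ->
  exists y i, P y /\ i <= length w /\ (e o y + e y (p i0) = e o (p i0))%Z /\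
    (e o y <= 2 * D + M)%Z /\ (e y (p i) <= D)%Z /\ (2 * D <= C2 o y (p i))%Z.
Proof.
  intros Hi0 HU. pose proof (proj1 Uo) as Po. pose proof (path_in i0) as Pq.
  destruct (Z.le_gt_cases (2 * D) (e o (p i0))) as [Hle|Hgt].
  - destruct (HM (gmul (ginv o) (p i0)) (2 * D)%Z) as [u [U1 [U2 U3]]].
    { now apply P_diff. }
    { fold (e o (p i0)). lia. }
    assert (Py : P (gmul o u)) by (now apply sub_mul).
    assert (E1 : e o (gmul o u) = ell u) by (unfold e; now rewrite gmulKV).
    assert (E2 : e (gmul o u) (p i0) = e u (gmul (ginv o) (p i0))).
    { rewrite <- (e_mul o u). now rewrite gmulVK. }
    assert (E3 : (e o (gmul o u) + e (gmul o u) (p i0) = e o (p i0))%Z)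
      by (rewrite E1, E2; exact U2).
    destruct (near (gmul o u)) as [i [I1 I2]]; [now apply HU|].
    exists (gmul o u), i. repeat split; auto; try lia.
    unfold C2. pose proof (far i). lia.
  - exists (p i0), i0. repeat split; auto.
    + rewrite e_refl. lia.
    + lia.
    + rewrite e_refl. lia.
    + unfold C2. rewrite e_refl. pose proof (far i0). lia.
Qed.

(** Seen from [o], the points [y] and [z] towards the two ends have doubled product at most [E],
    while the path through [p i] and [p j] forces it to be at least [2 D - R - 2 d k - 4 d]. *)
Lemma farthest_bound k : (6 * D + (2 * M + 1) <= Z.of_nat (2 ^ k))%Z ->
  (2 * D <= E + R + 4 * d + 2 * d * Z.of_nat k)%Z.
Proof.
  intros Hk. destruct Uo as [Po Eo].
  assert (P1 : P gone) by (now apply sub_one).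
  assert (E0 : p 0 = gone) by reflexivity.
  assert (EN : p (length w) = g) by (unfold p; now rewrite firstn_all).
  destruct (side_point 0) as [y [i [Y1 [Y2 [Y3 [Y4 [Y5 Y6]]]]]]]; [lia| |].
  { intros y Py Ey. split; [assumption|]. rewrite E0, !e_to_one in Ey by assumption.
    pose proof (e_tri y o g Py Po Hg). rewrite (e_sym y o) in * by assumption. lia. }
  destruct (side_point (length w)) as [z [j [Z1 [Z2 [Z3 [Z4 [Z5 Z6]]]]]]]; [lia| |].
  { intros z Pz Ez. split; [assumption|]. rewrite EN in Ez.
    pose proof (e_tri gone o z P1 Po Pz). rewrite !e_one in *. lia. }
  rewrite E0, !e_to_one in Y3 by assumption. rewrite EN in Z3.
  pose proof (path_in i) as Pi. pose proof (path_in j) as Pj.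
  assert (Hyz : (C2 o y z <= E)%Z).
  { unfold C2. pose proof (e_tri gone y g P1 Y1 Hg). pose proof (e_tri y z g Y1 Z1 Hg).
    rewrite !e_one in *. lia. }
  (* From [p i] through [y], [o], [z] to [p j] the legs are at most [D], [2 D + M], [2 D + M] and
     [D]. *)
  assert (Hij : (e (p i) (p j) + 1 <= Z.of_nat (2 ^ k))%Z).
  { pose proof (e_tri (p i) y (p j) Pi Y1 Pj). pose proof (e_tri y o (p j) Y1 Po Pj).
    pose proof (e_tri o z (p j) Po Z1 Pj).
    rewrite (e_sym (p i) y), (e_sym y o) in * by assumption. lia. }
  pose proof (path_nearby_C2 o D i j k Po far Y2 Z2 Hij HD) as H.
  assert (Es : C2 o (p j) z = C2 o z (p j)) by (unfold C2; rewrite (e_sym z) by assumption; lia).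
  assert (0 <= d * Z.of_nat k)%Z by nia.
  assert (0 <= R)%Z by (unfold R; lia).
  destruct (C2_hyp o y (p i) z) as [A|A]; auto; [lia|].
  destruct (C2_hyp o (p i) (p j) z) as [B|B]; auto; lia.
Qed.
End Farthest.
End Morse.

(* The Morse lemma: among the approximate geodesic points the farthest one from
   the word geodesic is at bounded distance, as the word geodesic would otherwise
   make a detour of linear length around a ball of that radius. *)
Lemma geodesic_near_word E : (0 <= E)%Z -> exists C, (0 <= C)%Z /\
  forall g w u, word_over S w -> word_eval w = g ->
    (forall w', word_over S w' -> word_eval w' = g -> length w <= length w') ->
    P u -> (ell u + e u g <= ell g + E)%Z ->
    exists i, i <= length w /\ (e u (word_eval (firstn i w)) <= C)%Z.
Proof.
  intros HE.
  destruct (logarithmic_bound (E + R + 4 * d) (2 * d) (2 * M + 1)) as [C [HC1 HC2]];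
    try (unfold R; lia).
  exists C. split; [assumption|]. intros g w u Hw Ew Hmin Hu Hug. apply NNPP. intros Hno.
  assert (Hg : P g) by (rewrite <- Ew; now apply word_over_in).
  set (U := fun v => P v /\ (ell v + e v g <= ell g + E)%Z).
  set (Q := fun D => exists v, U v /\ forall i, i <= length w -> (D <= e v (word_eval (firstn i w)))%Z).
  (* The path starts at [gone], so no point of [U] is farther from it than its own length, at most
     [ell g + E]. *)
  destruct (bounded_maximum Q (ell g + E) (C + 1)) as [D [D1 [[o [Uo Ho]] D3]]].
  - intros D [v [[V1 V2] V3]]. specialize (V3 0 ltac:(lia)). simpl in V3.
    rewrite e_to_one in V3 by assumption.
    pose proof (e_nonneg v g V1 Hg). lia.
  - exists u. split; [now split|]. intros i Hi. apply Z.le_ngt. intros Hlt. apply Hno.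
    exists i. split; [assumption|lia].
  - assert (D <= C)%Z; [|lia]. apply HC2; [lia|]. intros k Hk.
    apply (farthest_bound g w Hw Ew Hmin E D o); auto; try lia.
    + intros a. destruct (Nat.le_gt_cases a (length w)) as [Ha|Ha]; [auto|].
      specialize (Ho (length w) ltac:(lia)). rewrite firstn_all2 in Ho by lia.
      now rewrite firstn_all2 by lia.
    + intros v Hv. apply NNPP. intros Hn. apply D3. exists v. split; [assumption|].
      intros i Hi. apply Z.le_ngt. intros Hlt. apply Hn. exists i. split; [assumption|lia].
Qed.

(** * Transfer of hyperbolicity to the word metric *)

Section WordLength.
Variable wl : G -> nat.
Hypothesis Hwl : forall g, P g -> is_wlen S g (wl g).

Lemma wl_le g w : P g -> word_over S w -> word_eval w = g -> wl g <= length w.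
Proof. intros Hg. apply (Hwl g Hg). Qed.

Lemma wl_mul g h : P g -> P h -> wl (gmul g h) <= wl g + wl h.
Proof.
  intros Hg Hh. destruct (Hwl g Hg) as [[v [V1 [V2 <-]]] _]. destruct (Hwl h Hh) as [[w [W1 [W2 <-]]] _].
  rewrite <- length_app. apply wl_le; [now apply sub_mul|now apply word_over_app|].
  rewrite word_eval_app. congruence.
Qed.

Lemma wl_inv_le g : P g -> wl (ginv g) <= wl g.
Proof.
  intros Hg. destruct (Hwl g Hg) as [[v [V1 [V2 <-]]] _].
  rewrite <- (length_map ginv v), <- (length_rev (map ginv v)).
  apply wl_le; [now apply sub_inv|now apply word_over_inv|]. rewrite word_eval_inv. congruence.
Qed.

Lemma wl_inv g : P g -> wl (ginv g) = wl g.
Proof.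
  intros Hg. apply Nat.le_antisymm; [now apply wl_inv_le|].
  rewrite <- (ginv_inv G g) at 1. apply wl_inv_le. now apply sub_inv.
Qed.

Lemma wl_short g : P g -> (Z.of_nat (wl g) <= ell g + 1)%Z.
Proof.
  intros Hg. destruct (short_word g Hg) as [w [W1 [W2 W3]]]. pose proof (wl_le g w Hg W1 W2). lia.
Qed.

Let W (x y : G) : Z := Z.of_nat (wl (gmul (ginv x) y)).

Lemma W_one x : W gone x = Z.of_nat (wl x).
Proof. unfold W. do 2 f_equal. grp. Qed.

Lemma W_sym x y : P x -> P y -> W x y = W y x.
Proof.
  intros Hx Hy. unfold W. rewrite <- wl_inv by (now apply P_diff). do 2 f_equal. grp.
Qed.

Lemma W_tri x y z : P x -> P y -> P z -> (W x z <= W x y + W y z)%Z.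
Proof.
  intros Hx Hy Hz. unfold W.
  replace (gmul (ginv x) z) with (gmul (gmul (ginv x) y) (gmul (ginv y) z)) by grp.
  pose proof (wl_mul (gmul (ginv x) y) (gmul (ginv y) z) (P_diff x y Hx Hy) (P_diff y z Hy Hz)). lia.
Qed.

Lemma W_short x y : P x -> P y -> (W x y <= e x y + 1)%Z.
Proof. intros Hx Hy. apply wl_short. now apply P_diff. Qed.

(** [u] is near a prefix point of a shortest word from [x] to [y]; the excursion to [u] and back
    costs at most [C + 1] each way in the word metric. *)
Lemma W_additive E : (0 <= E)%Z -> exists C, (0 <= C)%Z /\
  forall x u y, P x -> P u -> P y -> (e x u + e u y <= e x y + E)%Z ->
    (W x u + W u y <= W x y + C)%Z.
Proof.
  intros HE. destruct (geodesic_near_word E HE) as [C [C1 C2']].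
  exists (2 * C + 2)%Z. split; [lia|]. intros x u y Hx Hu Hy H.
  pose proof (P_diff x u Hx Hu) as Hxu. pose proof (P_diff x y Hx Hy) as Hxy.
  destruct (Hwl _ Hxy) as [[w [W1 [W2 W3]]] W4].
  destruct (C2' (gmul (ginv x) y) w (gmul (ginv x) u)) as [i [I1 I2]]; auto.
  { intros w' A1 A2. rewrite W3. auto. }
  { rewrite e_mul. exact H. }
  set (q := word_eval (firstn i w)) in *.
  assert (Hq : P q) by (apply word_over_in; now apply word_over_firstn).
  assert (Hxq : P (gmul x q)) by (now apply sub_mul).
  assert (A1 : (W x (gmul x q) <= Z.of_nat i)%Z).
  { unfold W. rewrite gmulKV. pose proof (wl_le q (firstn i w) Hq (word_over_firstn w W1 i) eq_refl) as A.
    rewrite length_firstn in A. lia. }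
  assert (A2 : (W (gmul x q) y <= Z.of_nat (wl (gmul (ginv x) y) - i))%Z).
  { unfold W. replace (gmul (ginv (gmul x q)) y) with (word_eval (skipn i w)).
    - pose proof (wl_le _ (skipn i w) (word_over_in _ (word_over_skipn w W1 i)) (word_over_skipn w W1 i) eq_refl) as A.
      rewrite length_skipn in A. lia.
    - apply (gmul_cancel_l G q). unfold q at 1. rewrite <- word_eval_app, firstn_skipn, W2. grp. }
  assert (A3 : e u (gmul x q) = e (gmul (ginv x) u) q).
  { rewrite <- (e_mul (ginv x) u). now rewrite gmulKV. }
  pose proof (W_tri x (gmul x q) u Hx Hxq Hu). pose proof (W_tri u (gmul x q) y Hu Hxq Hy).
  pose proof (W_short u (gmul x q) Hu Hxq).
  rewrite (W_sym (gmul x q) u) in * by assumption. unfold W in *. lia.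
Qed.

Lemma W_one_l x u E C : (forall x u y, P x -> P u -> P y -> (e x u + e u y <= e x y + E)%Z ->
    (W x u + W u y <= W x y + C)%Z) -> P x -> P u -> (ell u + e u x <= ell x + E)%Z ->
  (W gone u + W u x <= W gone x + C)%Z.
Proof.
  intros H Hx Hu Hux. apply H; auto; [now apply sub_one|]. now rewrite !e_one.
Qed.

(** Both points lie on geodesics from [gone] to [x], so the four point condition puts [v] coarsely
    between [gone] and [u]; the slack [d] in the order counts twice. *)
Lemma geodesic_points_near x u v : P x -> P u -> P v ->
  (ell u + e u x = ell x)%Z -> (ell v + e v x = ell x)%Z -> (ell v <= ell u + d)%Z ->
  (ell v + e v u <= ell u + 4 * d)%Z.
Proof.
  intros Hx Hu Hv Eu Ev Hle.
  pose proof (e_four gone v u x (sub_one G P SP) Hv Hu Hx) as F. rewrite !e_one in F. lia.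
Qed.

Lemma word_hyperbolic_inequality : exists B, (0 <= B)%Z /\ forall x y z, P x -> P y -> P z ->
  (Z.min (W gone x + W gone z - W x z) (W gone y + W gone z - W y z) - 2 * B
     <= W gone x + W gone y - W x y)%Z.
Proof.
  destruct (W_additive (4 * d)) as [C [C1 C3]]; [lia|].
  assert (P1 : P gone) by (now apply sub_one).
  exists (10 * (C + 4 * d + 1))%Z. split; [lia|]. intros x y z Hx Hy Hz.
  (* Regularity supplies a branch point [v] whose word length bounds the word-metric Gromov product
     up to a constant, so it remains to compare word lengths of branch points. *)
  assert (Upper : forall a b, P a -> P b -> exists v v', P v /\ P v' /\
    (2 * ell v = ell a + ell b - e a b)%Z /\ ell v' = ell v /\
    (ell v + e v a = ell a)%Z /\ (ell v' + e v' b = ell b)%Z /\ (e v v' <= 4 * d)%Z /\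
    (W gone a + W gone b - W a b <= 2 * W gone v + C)%Z).
  { intros a b Ha Hb.
    destruct (hl_reg _ _ _ HL a b Ha Hb) as [v [v' [V1 [V2 [V3 [V4 [V5 [V6 V7]]]]]]]].
    fold (e a b) in V3. fold (e v a) in V5. fold (e v' b) in V6. fold (e v v') in V7.
    exists v, v'. repeat split; auto.
    pose proof (e_tri v v' b V1 V2 Hb).
    pose proof (C3 a v b Ha V1 Hb) as H1. rewrite (e_sym a v) in H1 by assumption.
    specialize (H1 ltac:(lia)). rewrite (W_sym a v) in H1 by assumption.
    pose proof (W_tri gone v a P1 V1 Ha). pose proof (W_tri gone v b P1 V1 Hb). lia. }
  destruct (Upper x y Hx Hy) as [u [u' [U1 [U2 [U3 [U4 [U5 [U6 [U7 _]]]]]]]]].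
  assert (Wuu : (W u u' <= 4 * d + 1)%Z) by (pose proof (W_short u u' U1 U2); lia).
  pose proof (W_one_l x u (4 * d) C C3 Hx U1 ltac:(lia)) as L1.
  pose proof (W_one_l y u' (4 * d) C C3 Hy U2 ltac:(lia)) as L2.
  pose proof (W_tri gone u' u P1 U2 U1) as L3. pose proof (W_tri u u' y U1 U2 Hy) as L4.
  pose proof (W_tri x u y Hx U1 Hy) as L5. rewrite (W_sym x u) in L5 by assumption.
  pose proof (W_tri gone u u' P1 U1 U2) as L6. rewrite (W_sym u' u) in L3 by assumption.
  destruct (Upper x z Hx Hz) as [v [v' [V1 [V2 [V3 [V4 [V5 [V6 [V7 V8]]]]]]]]].
  destruct (Upper y z Hy Hz) as [t [t' [T1 [T2 [T3 [T4 [T5 [T6 [T7 T8]]]]]]]]].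
  pose proof (e_four gone x y z P1 Hx Hy Hz) as F. rewrite !e_one in F.
  (* The branch point of [x], [y] is at most [d] shorter in [ell] than that of [x], [z] or that of
     [y], [z]. *)
  destruct F as [F|F].
  - assert (Hle : (ell v <= ell u + d)%Z) by lia.
    pose proof (W_one_l u v (4 * d) C C3 U1 V1 (geodesic_points_near x u v Hx U1 V1 U5 V5 Hle)) as N.
    assert (0 <= W v u)%Z by (unfold W; lia). lia.
  - assert (Hle : (ell t <= ell u' + d)%Z) by lia.
    pose proof (W_one_l u' t (4 * d) C C3 U2 T1 (geodesic_points_near y u' t Hy U2 T1 U6 T5 Hle)) as N.
    assert (0 <= W t u')%Z by (unfold W; lia). lia.
Qed.
End WordLength.
End Words.

Lemma wlen_unique (S : list G) g a b : is_wlen S g a -> is_wlen S g b -> a = b.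
Proof.
  intros [[v [V1 [V2 <-]]] V3] [[w [W1 [W2 <-]]] W3].
  apply Nat.le_antisymm; auto.
Qed.

Lemma hyperbolic_length_word_hyperbolic : word_hyperbolic_sub P.
Proof.
  destruct coarse_geodesic as [M [M1 M2]].
  destruct (hl_proper _ _ _ HL (M + 1)) as [F HF].
  destruct (list_restrict G (fun g => P g /\ (ell g <= M + 1)%Z) F) as [S HS'].
  assert (HS : forall g, In g S <-> P g /\ (ell g <= M + 1)%Z).
  { intros g. rewrite HS'. split; [tauto|]. intros [H1 H2]. auto. }
  exists S. split.
  { split; [intros x Hx; now apply HS|]. intros g Hg.
    destruct (short_word M S M1 M2 HS g Hg) as [w [W1 [W2 _]]]. now exists w. }
  assert (Hex : forall g, exists N, P g -> is_wlen S g N).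
  { intros g. destruct (classic (P g)) as [Hg|Hg]; [|exists 0; tauto].
    destruct (wlen_exists M S M1 M2 HS g Hg) as [N HN]. now exists N. }
  set (wl := fun g => proj1_sig (constructive_indefinite_description _ (Hex g))).
  assert (Hwl : forall g, P g -> is_wlen S g (wl g))
    by (intros g; exact (proj2_sig (constructive_indefinite_description _ (Hex g)))).
  destruct (word_hyperbolic_inequality M S M1 M2 HS wl Hwl) as [B [B1 B2]].
  exists (Z.to_nat B). intros x y z Hx Hy Hz lx ly lz lxy lxz lyz I1 I2 I3 I4 I5 I6.
  specialize (B2 x y z Hx Hy Hz). rewrite !(W_one wl) in B2.
  rewrite (wlen_unique S _ _ _ I1 (Hwl x Hx)), (wlen_unique S _ _ _ I2 (Hwl y Hy)),
    (wlen_unique S _ _ _ I3 (Hwl z Hz)), (wlen_unique S _ _ _ I4 (Hwl _ (P_diff x y Hx Hy))),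
    (wlen_unique S _ _ _ I5 (Hwl _ (P_diff x z Hx Hz))), (wlen_unique S _ _ _ I6 (Hwl _ (P_diff y z Hy Hz))).
  rewrite Z2Nat.id by assumption. exact B2.
Qed.
End WordHyperbolic.

(** * The groups [G_k]: hyperbolic base and HNN steps *)

Lemma predicate_ext (X : Type) (P Q : X -> Prop) : (forall x, P x <-> Q x) -> P = Q.
Proof.
  intros H. apply functional_extensionality. intros x. now apply propositional_extensionality.
Qed.

Lemma height_one_eq_kv n (delta : vec) : vle n vzero delta -> ht n delta = 1 ->
  1 <= n /\ (0 < delta 1%nat)%Z /\ veq n delta (kv (delta 1%nat)).
Proof.
  intros H0 Hht.
  assert (Hn : 1 <= n) by (destruct n; [discriminate|lia]).
  assert (Hz : forall i, 1 < i <= n -> delta i = 0%Z) by (apply (proj1 (ht_le_iff n delta 1)); lia).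
  split; [assumption|]. split.
  - assert (vzero 1%nat <= delta 1%nat)%Z.
    { apply (vle_coord n vzero delta 1); [assumption|lia|]. intros i Hi. rewrite Hz by lia. reflexivity. }
    unfold vzero in *. destruct (Z.eq_dec (delta 1%nat) 0) as [E|E]; [|lia].
    assert (ht n delta <= 0); [|lia].
    apply (proj2 (ht_le_iff n delta 0)). intros i Hi. destruct (Nat.eq_dec i 1) as [->|]; [assumption|]. apply Hz. lia.
  - intros i Hi. destruct (Nat.eq_dec i 1) as [->|Hne]; [reflexivity|].
    rewrite Hz, kv_coord by lia. reflexivity.
Qed.

Section Structure.
Variables (G : Group) (n : nat) (l : G -> vec) (delta : vec) (d : Z).
Hypothesis Hn : 1 <= n.
Hypothesis Hd : (0 < d)%Z.
Hypothesis Hdelta : veq n delta (kv d).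
Hypothesis Hl : length_function n l.
Hypothesis Hhyp : hyperbolic_lf n l delta.
Hypothesis Hreg : regular_lf n l delta.
Hypothesis Hprop : proper_lf n l.
Hypothesis Htf : torsion_free G.

Lemma G1_hyperbolic_length : fin_gen_sub (Gk n l 1) ->
  hyperbolic_length (Gk n l 1) (fun g => l g 1%nat) d.
Proof.
  intros Hfg. pose proof (Gk_subgroup G n l Hl 1) as SP.
  assert (HP : forall g, Gk n l 1 g -> forall i, 1 < i <= n -> l g i = 0%Z)
    by (intros g; apply Gk_iff).
  assert (Hmul : forall g h, Gk n l 1 g -> Gk n l 1 h -> Gk n l 1 (gmul (ginv g) h)).
  { intros g h Hg Hh. apply sub_mul; auto. now apply sub_inv. }
  assert (Hkv : forall z i, 1 < i -> kv z i = 0%Z) by apply kv_coord.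
  split.
  - exact SP.
  - lia.
  - now rewrite (l_one G n l Hl) by lia.
  - intros g Hg. apply (vle_coord n vzero (l g) 1 (l_nonneg G n l Hl g)); [lia|].
    intros i Hi. now rewrite HP by auto.
  - intros g Hg. apply (l_inv G n l Hl). lia.
  - intros g h Hg Hh. change (l g 1%nat + l h 1%nat)%Z with (vadd (l g) (l h) 1%nat).
    apply (vle_coord n); [apply (l_mul G n l Hl)|lia|]. intros i Hi. unfold vadd.
    rewrite !HP; auto. now apply sub_mul.
  - intros f g h Hf Hg Hh.
    pose proof (four_points G n l delta d Hdelta Hhyp gone f g h) as H.
    rewrite !dist_one in H. unfold dist in H.
    destruct H as [H|H]; [left|right]; apply (vle_coord n _ _ 1) in H; try lia.
    + exact H.
    + intros i Hi. unfold vadd. rewrite !HP, Hkv; auto; lia.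
    + exact H.
    + intros i Hi. unfold vadd. rewrite !HP, Hkv; auto; lia.
  - intros g h Hg Hh. destruct (Hreg g h) as [u [v [gd [hd [E1 [E2 [[-> E3] [[-> E4] E5]]]]]]]].
    assert (Hu : Gk n l 1 u).
    { apply (Gk_le G n l Hl 1 u (gmul u gd)); [assumption|]. pose proof (l_nonneg G n l Hl gd). vlia. }
    assert (Hv : Gk n l 1 v).
    { apply (Gk_le G n l Hl 1 v (gmul v hd)); [assumption|]. pose proof (l_nonneg G n l Hl hd). vlia. }
    exists u, v. split; [assumption|]. split; [assumption|].
    assert (H4 : vle n (l (gmul (ginv u) v)) (kv (4 * d))) by (pose proof (kv_scale n 4 d); vlia).
    specialize (E1 1 ltac:(lia)). specialize (E2 1 ltac:(lia)).
    specialize (E3 1 ltac:(lia)). specialize (E4 1 ltac:(lia)).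
    unfold c2, vscale, vadd, vsub in E1, E2, E3, E4. rewrite !gmulKV.
    split; [exact E1|]. split; [lia|]. split; [lia|]. split; [lia|].
    apply (vle_coord n _ _ 1) in H4; [exact H4|lia|].
    intros i Hi. rewrite HP, Hkv; auto; lia.
  - intros m. destruct (Hprop (Z.to_nat m)) as [F HF]. exists F. intros g Hg Hm.
    apply HF. change (vle n (l g) (kv (Z.of_nat (Z.to_nat m)))).
    apply vle_of_coord; [unfold kv; simpl; lia|]. intros i Hi. rewrite HP, Hkv by (auto; lia). reflexivity.
  - exact Hfg.
Qed.

Lemma kernel_eq k : 1 <= k < n ->
  length_kernel (Gk n l (S k)) (fun g => l g (S k)) = Gk n l k.
Proof. intros Hk. apply predicate_ext. intros g. symmetry. now apply Gk_kernel. Qed.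

(** Induction on [n - k], starting from [G_n = G] and descending by [base_fin_gen]. *)
Lemma Gk_fin_gen k : fin_gen G -> 1 <= k <= n -> fin_gen_sub (Gk n l k).
Proof.
  intros Hfg Hk. assert (E : exists j, k = n - j) by (exists (n - k); lia).
  destruct E as [j ->]. induction j as [|j IH].
  - destruct Hfg as [S [_ HS]]. exists S. split; [|intros g _; now apply HS].
    intros x _. apply Gk_iff. intros i Hi. lia.
  - assert (Ej : n - j = S (n - S j)) by lia. rewrite Ej in IH.
    set (k := n - S j) in *. specialize (IH ltac:(lia)).
    assert (Hk' : 1 <= k < n) by lia.
    pose proof (base_fin_gen G _ _ (tree_length_top G n l delta d Hdelta Hl Hhyp Hreg k Hk')) as H.
    rewrite (kernel_eq k Hk') in H.
    apply H; [|exact IH|].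
    + intros s Hs Hss. now apply (no_edge_flip G n l delta d).
    + intros t Ht Ht0.
      apply (edge_fin_gen G n l delta d Hdelta Hl Hhyp Hreg Hprop Hn Hd k t Hk' Ht).
      intros Hc. apply (Gk_kernel G n l k t Hk') in Hc. lia.
Qed.

Lemma Gk_succ_HNN k : fin_gen_sub (Gk n l (S k)) -> 1 <= k < n ->
  exists (m : nat) (A B : nat -> G -> Prop) (phi : nat -> G -> G) (iota : G -> G) (t : nat -> G),
    is_HNN_extension (Gk n l (S k)) (Gk n l k) m A B phi iota t /\
    forall i, i < m -> virt_nilp3 (A i) /\ virt_nilp3 (B i).
Proof.
  intros Hfg Hk. pose proof (tree_length_top G n l delta d Hdelta Hl Hhyp Hreg k Hk) as TL.
  assert (Hflip : forall s, Gk n l (S k) s ->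
    length_kernel (Gk n l (S k)) (fun g => l g (S k)) (gmul s s) ->
    length_kernel (Gk n l (S k)) (fun g => l g (S k)) s).
  { rewrite kernel_eq by assumption. intros s. now apply (no_edge_flip G n l delta d). }
  destruct (finitely_many_letters G _ _ TL Hflip Hfg) as [S0 [T [HS [good Hgen]]]].
  pose proof (letters_HNN G _ _ TL S0 T HS good Hgen) as HNN.
  rewrite (kernel_eq k Hk) in HNN.
  do 6 eexists. split; [exact HNN|]. intros i Hi. cbv beta.
  destruct (proj1 good i Hi) as [T1 [T2 _]]. cbv beta in T1, T2.
  set (t := nth i T gone) in *.
  assert (Hno : ~ Gk n l k t).
  { intros Hc. apply (Gk_kernel G n l k t Hk) in Hc. lia. }
  assert (SP := Gk_subgroup G n l Hl (S k)). assert (SK := Gk_subgroup G n l Hl k).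
  split.
  (* [A i] is the stabilizer of the edge given by [t^-1], and [B i] that of the edge given by
     [t]. *)
  - rewrite (predicate_ext G (fun a => Gk n l k a /\ Gk n l k (gmul (gmul t a) (ginv t)))
      (fun a => Gk n l k a /\ Gk n l k (gmul (ginv (ginv t)) (gmul a (ginv t))))).
    + apply (edge_virt_nilp G n l delta d Hdelta Hl Hhyp Hreg Hprop Hn Hd k (ginv t) Hk).
      * now apply sub_inv.
      * intros Hc. apply Hno. rewrite <- (ginv_inv G t). now apply sub_inv.
    + intros a. now rewrite ginv_inv, gmulA.
  - rewrite (predicate_ext G (fun b => Gk n l k b /\ Gk n l k (gmul (gmul (ginv t) b) t))
      (fun b => Gk n l k b /\ Gk n l k (gmul (ginv t) (gmul b t)))).
    + now apply (edge_virt_nilp G n l delta d Hdelta Hl Hhyp Hreg Hprop Hn Hd k t Hk).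
    + intros b. now rewrite gmulA.
Qed.
End Structure.

Theorem theorem3p1 (G : Group) (n : nat) (l : G -> vec) (delta : vec) :
  fin_gen G -> torsion_free G ->
  vle n vzero delta ->
  length_function n l -> proper_lf n l ->
  regular_lf n l delta -> hyperbolic_lf n l delta ->
  ht n delta = 1%nat ->
  is_subgroup (Gk n l 1) -> fin_gen_sub (Gk n l 1) -> isolated (Gk n l 1) ->
  (forall k, (1 <= k <= n)%nat -> is_subgroup (Gk n l k)) /\
  (forall k, (1 <= k < n)%nat -> forall g, Gk n l k g -> Gk n l (S k) g) /\
  (forall g : G, Gk n l n g) /\
  word_hyperbolic_sub (Gk n l 1) /\
  (forall k, (1 <= k < n)%nat ->
     exists (m : nat) (A B : nat -> G -> Prop) (phi : nat -> G -> G)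
            (iota : G -> G) (t : nat -> G),
       is_HNN_extension (Gk n l (S k)) (Gk n l k) m A B phi iota t /\
       (forall i, (i < m)%nat -> virt_nilp3 (A i) /\ virt_nilp3 (B i))).
Proof.
  intros Hfg Htf H0 Hl Hprop Hreg Hhyp Hht _ Hfg1 _.
  destruct (height_one_eq_kv n delta H0 Hht) as [Hn [Hd Hdelta]].
  split; [|split; [|split; [|split]]].
  - intros k _. now apply Gk_subgroup.
  - intros k _ g. unfold Gk. lia.
  - intros g. apply Gk_iff. intros i Hi. lia.
  - apply (hyperbolic_length_word_hyperbolic G (Gk n l 1) (fun g => l g 1) (delta 1)).
    now apply (G1_hyperbolic_length G n l delta (delta 1)).
  - intros k Hk.
    apply (Gk_succ_HNN G n l delta (delta 1) Hn Hd Hdelta Hl Hhyp Hreg Hprop Htf k); [|assumption].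
    apply (Gk_fin_gen G n l delta (delta 1)); auto. lia.
Qed.
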